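(* Let $n$ be a natural number and $H=\{1,\dots,n\}\times\mathbb{N}$, $\mathbb N=\{1,2,\dots\}$. Let $(\mathcal{Q}^{(a)}_m(y))_{(a,m)\in H}$ be the canonical solution of a $Q$-system of KR type with matrices $D$, $G$ and integers $g_{ab}$ (as defined in the context), i.e. of $$(\mathcal{Q}^{(a)}_m(y))^2=\mathcal{Q}^{(a)}_{m-1}(y)\,\mathcal{Q}^{(a)}_{m+1}(y)+(y_a)^m(\mathcal{Q}^{(a)}_m(y))^2\prod_{(b,k)\in H}(\mathcal{Q}^{(b)}_k(y))^{G_{am,bk}}\qquad((a,m)\in H),$$ with $\mathcal{Q}^{(a)}_0(y)=1$. Let $y_a(x)=\prod_{b=1}^n(x_b)^{-g_{ab}}$, let $\mathbf{Q}^{(a)}_1(x)=x_a\mathcal{Q}^{(a)}_1(y(x))$, and let $\mathbf{K}^0_{D,G}(x)=\mathcal{K}^0_{D,G}(y(x))$, with $\mathcal K^0_{D,G}(y)$ as in the context. Then $$\mathbf{K}^0_{D,G}(x)=\det_{1\le a,b\le n}\Bigl(\frac{\partial\mathbf{Q}^{(a)}_1}{\partial x_b}(x)\Bigr).$$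
   Context: $Q$-system of KR type: the system above for families of power series $\mathcal{Q}^{(a)}_m(y)\in\mathbb{C}[[y]]$, $y=(y_a)_{a=1}^n$, with constant terms $1$, where $G=(G_{am,bk})_{(a,m),(b,k)\in H}$ is a complex matrix and (KR-I) $D_{am,bk}=-\delta_{ab}(2\delta_{mk}-\delta_{m,k+1}-\delta_{m,k-1})$ and $(D^{-1})_{am,bk}=-\delta_{ab}\min(m,k)$, and the product $G'=GD^{-1}$ is well-defined (each entry is a sum with all but finitely many terms zero); (KR-II) there is a well-order $\prec$ on $H$ such that $G'_{am,bk}=g_{ab}m$ whenever $(a,m)\preceq(b,k)$, where $g_{ab}$ ($a,b=1,\dots,n$) are integers with $\det_{1\le a,b\le n}g_{ab}\neq0$. Complex powers of a series with constant term $1$ are those with constant term $1$; infinite products are taken in the standard topology of $\mathbb{C}[[y]]$, irrespective of order. A solution is canonical if for all $(a,m)\in H$, $\prod_{(b,k)\in H}\{\prod_{(c,j)\in H}(\mathcal{Q}^{(c)}_j(y))^{(D^{-1})_{am,bk}D_{bk,cj}}\}=\mathcal{Q}^{(a)}_m(y)$; a unique canonical solution exists. $\mathcal{K}^0_{D,G}(y)=\sum_N\prod_{(a,m):\,N^{(a)}_m\ne0}\binom{P^{(a)}_m+N^{(a)}_m}{N^{(a)}_m}\prod_{(a,m)\in H}(y_a)^{mN^{(a)}_m}$, the sum over $N=(N^{(a)}_m)_{(a,m)\in H}$ with $N^{(a)}_m\in\mathbb{Z}_{\ge0}$, all but finitely many zero, where $P^{(a)}_m=-\sum_{(b,k)\in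 H}N^{(b)}_kG'_{bk,am}$ and $\binom ab=\frac{\Gamma(a+1)}{\Gamma(a-b+1)\Gamma(b+1)}$ (limit value at singularities). For $f\in\mathbb{C}[[y]]$, $f(y(x))$ is the formal Laurent series in $x=(x_a)_{a=1}^n$ obtained by substituting the Laurent monomials $y_a(x)$ (distinct monomials in $y$ give distinct monomials in $x$ since $\det g_{ab}\ne0$); derivatives are taken termwise. *)

(* Defs.v *)
From HB Require Import structures.
From mathcomp Require Import all_boot all_order all_algebra all_fingroup.
From mathcomp Require Import finmap complex.
From mathcomp Require Import all_classical all_reals all_analysis.

Set Implicit Arguments.
Unset Strict Implicit.
Unset Printing Implicit Defensive.

Import Order.TTheory GRing.Theory Num.Theory.
Import numFieldNormedType.Exports.

Local Open Scope classical_set_scope.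
Local Open Scope complex_scope.
Local Open Scope ring_scope.

Notation mindex n := {ffun 'I_n -> nat}.

Record pseries (n : nat) (K : comNzRingType) :=
  PSeries { pscoef :> mindex n -> K }.

HB.instance Definition _ (n : nat) (K : comNzRingType) :=
  gen_eqMixin (pseries n K).
HB.instance Definition _ (n : nat) (K : comNzRingType) :=
  gen_choiceMixin (pseries n K).

Lemma psP (n : nat) (K : comNzRingType) (f g : pseries n K) :
  (forall e, f e = g e) -> f = g.
Proof. by case: f g => [f] [g] fg; congr PSeries; apply/funext. Qed.

Definition psadd n (K : comNzRingType) (f g : pseries n K) :=
  PSeries (fun e => f e + g e).
Definition psopp n (K : comNzRingType) (f : pseries n K) :=
  PSeries (fun e => - f e).
Definition psmul n (K : comNzRingType) (f g : pseries n K) :=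
  PSeries (fun e => \sum_(p \in [set p : mindex n * mindex n | p.1 + p.2 = e])
                       f p.1 * g p.2).
Definition psmon n (K : comNzRingType) (e : mindex n) : pseries n K :=
  PSeries (fun d => (d == e)%:R).

Lemma psaddA n K : associative (@psadd n K).
Proof. by move=> f g h; apply: psP => e /=; rewrite addrA. Qed.
Lemma psaddC n K : commutative (@psadd n K).
Proof. by move=> f g; apply: psP => e /=; rewrite addrC. Qed.
Lemma psadd0 n (K : comNzRingType) :
  left_id (PSeries (fun=> 0)) (@psadd n K).
Proof. by move=> f; apply: psP => e /=; rewrite add0r. Qed.
Lemma psaddN n (K : comNzRingType) :
  left_inverse (PSeries (fun=> 0)) (@psopp n K) (@psadd n K).
Proof. by move=> f; apply: psP => e /=; rewrite addNr. Qed.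

HB.instance Definition _ (n : nat) (K : comNzRingType) :=
  GRing.isZmodule.Build (pseries n K)
    (@psaddA n K) (@psaddC n K) (@psadd0 n K) (@psaddN n K).

Definition mdecomp n (e : mindex n) : set (mindex n * mindex n) :=
  [set p | p.1 + p.2 = e].

Lemma finite_mdecomp n (e : mindex n) : finite_set (mdecomp e).
Proof.
pose B := (\sum_i e i).+1.
pose h (p : {ffun 'I_n -> 'I_B} * {ffun 'I_n -> 'I_B}) : mindex n * mindex n :=
  ([ffun i => val (p.1 i)], [ffun i => val (p.2 i)]).
apply: (@sub_finite_set _ _ (h @` setT)); last first.
  exact/finite_image/finite_finset.
move=> p /= pe.
have leB i : (e i < B)%N by rewrite /B ltnS (bigD1 i) //= leq_addr.
have p1 i : (p.1 i < B)%N.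
  by apply: leq_ltn_trans (leB i); rewrite -pe ffunE leq_addr.
have p2 i : (p.2 i < B)%N.
  by apply: leq_ltn_trans (leB i); rewrite -pe ffunE leq_addl.
exists ([ffun i => Ordinal (p1 i)], [ffun i => Ordinal (p2 i)]) => //.
by case: p {pe} p1 p2 => u v p1 p2; rewrite /h /=; congr pair;
  apply/ffunP => i; rewrite !ffunE.
Qed.

Definition mdec n (e : mindex n) := fset_set (mdecomp e).

Lemma mem_mdec n (e : mindex n) p : (p \in mdec e) = (p.1 + p.2 == e).
Proof.
rewrite /mdec in_fset_set; last exact: finite_mdecomp.
by apply/idP/eqP => [/set_mem|pe]; [|apply/mem_set].
Qed.

Lemma psmulE n (K : comNzRingType) (f g : pseries n K) e :
  psmul f g e = \sum_(p <- mdec e) f p.1 * g p.2.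
Proof. by rewrite /= fsbig_finite //; exact: finite_mdecomp. Qed.

Lemma psmulC n K : commutative (@psmul n K).
Proof.
move=> f g; apply: psP => e; rewrite !psmulE.
pose sw (p : mindex n * mindex n) := (p.2, p.1).
have swI : injective sw by move=> [? ?] [? ?] [-> ->].
have pe : perm_eq (mdec e) [seq sw p | p <- mdec e].
  apply: uniq_perm; rewrite ?map_inj_uniq ?fset_uniq // => p.
  have -> : p = sw (sw p) by case: p.
  by rewrite mem_map // !mem_mdec /= addrC.
rewrite (perm_big _ pe) big_map /=.
by apply: eq_bigr => p _; rewrite mulrC.
Qed.

Lemma psmulDl n K : left_distributive (@psmul n K) (@psadd n K).
Proof.
move=> f g h; apply: psP => e; rewrite -[RHS]/(psmul f h e + psmul g h e).
rewrite !psmulE -big_split /=.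
by apply: eq_bigr => p _; rewrite mulrDl.
Qed.

Lemma psmul1 n K : left_id (psmon K 0) (@psmul n K).
Proof.
move=> f; apply: psP => e; rewrite psmulE.
rewrite (bigD1_seq (0, e)) ?fset_uniq ?mem_mdec ?add0r //= eqxx mul1r.
rewrite big1_seq ?addr0 // => -[u v] /=.
rewrite mem_mdec xpair_eqE /=; case: eqVneq => [->|_ _]; last by rewrite mul0r.
by rewrite add0r => /andP[/negP ne /ne].
Qed.

Lemma psmulA n K : associative (@psmul n K).
Proof.
move=> f g h; apply: psP => e; rewrite !psmulE.
pose T := (mindex n * mindex n * mindex n)%type.
pose F (t : T) := f t.1.1 * g t.1.2 * h t.2.
pose L := [seq ((p.1, q.1), q.2) | p <- mdec e, q <- mdec p.2].
pose R := [seq (q, p.2) | p <- mdec e, q <- mdec p.1].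
have LE : (\sum_(t <- L) F t) = \sum_(p <- mdec e) f p.1 * psmul g h p.2.
  rewrite /L big_allpairs_dep; apply: eq_bigr => p _.
  by rewrite psmulE big_distrr /=; apply: eq_bigr => q _; rewrite /F mulrA.
have RE : (\sum_(t <- R) F t) = \sum_(p <- mdec e) psmul f g p.1 * h p.2.
  rewrite /R big_allpairs_dep; apply: eq_bigr => p _.
  by rewrite psmulE big_distrl.
rewrite -LE -RE; apply/perm_big/uniq_perm.
- apply: allpairs_uniq_dep => [|p _|]; rewrite ?fset_uniq //.
  move=> x y /allpairsPdep[[p1 p2] [[q1 q2] [_ qp ->]]].
  move=> /allpairsPdep[[r1 r2] [[s1 s2] [_ sr ->]]] /=.
  by move: qp sr; rewrite !mem_mdec /= => /eqP <- /eqP <- [-> -> ->].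
- apply: allpairs_uniq_dep => [|p _|]; rewrite ?fset_uniq //.
  move=> x y /allpairsPdep[[p1 p2] [[q1 q2] [_ qp ->]]].
  move=> /allpairsPdep[[r1 r2] [[s1 s2] [_ sr ->]]] /=.
  by move: qp sr; rewrite !mem_mdec /= => /eqP <- /eqP <- [-> -> ->].
move=> [[u v] w]; apply/allpairsPdep/allpairsPdep.
- move=> [[p1 p2] [[q1 q2] [+ + [-> -> ->]]]].
  rewrite !mem_mdec /= => /eqP <- /eqP <-.
  by exists (p1 + q1, q2), (p1, q1); rewrite !mem_mdec /= addrA.
- move=> [[p1 p2] [[q1 q2] [+ + [-> -> ->]]]].
  rewrite !mem_mdec /= => /eqP <- /eqP <-.
  by exists (q1, q2 + p2), (q2, p2); rewrite !mem_mdec /= addrA.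
Qed.

Lemma psmon0_neq0 n (K : comNzRingType) : psmon K 0 != 0 :> pseries n K.
Proof.
apply/eqP => /(congr1 (fun f : pseries n K => f 0)) /=.
by rewrite eqxx; apply/eqP; exact: oner_neq0.
Qed.

HB.instance Definition _ (n : nat) (K : comNzRingType) :=
  GRing.Zmodule_isComNzRing.Build (pseries n K)
    (@psmulA n K) (@psmulC n K) (@psmul1 n K) (@psmulDl n K)
    (@psmon0_neq0 n K).

Definition psC n (K : comNzRingType) (c : K) : pseries n K :=
  PSeries (fun d => c * (d == 0)%:R).

Definition psX n (K : comNzRingType) (a : 'I_n) : pseries n K :=
  psmon K [ffun b => nat_of_bool (b == a)].

(* The sum of a family that is summable in K[[y]], i.e. such that every
   coefficient is nonzero in finitely many members only. *)
Definition pssum n (K : comNzRingType) (I : choiceType)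
    (F : I -> pseries n K) : pseries n K :=
  PSeries (fun e => \sum_(i \in [set: I]) F i e).

(* Unconditional convergence of the product to p in the (y_1, ..., y_n)-adic
   topology: the net of the products over finite subsets of I tends to p. *)
Definition is_infprod n (K : comNzRingType) (I : choiceType)
    (F : I -> pseries n K) (p : pseries n K) : Prop :=
  forall d : nat, exists A0 : {fset I}, forall A : {fset I},
    (A0 `<=` A)%fset ->
    forall e : mindex n, (\sum_a e a < d)%N -> (\prod_(i <- A) F i) e = p e.

Definition cexp (R : realType) (z : R[i]) : R[i] :=
  (expR (complex.Re z))%:C * (cos (complex.Im z) +i* sin (complex.Im z)).

(* Euler's formula
   Gamma(z) = lim_k k^z k! / (z (z + 1) ... (z + k)), with k^z = exp(z ln k);
   the value at the poles 0, -1, -2, ... is irrelevant. *)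
Definition cGamma (R : realType) (z : R[i]) : R[i] :=
  limn (fun k : nat =>
    cexp (z * (ln k%:R)%:C) * (k`!)%:R / \prod_(j < k.+1) (z + j%:R) : R[i]^o).

(* The limit in the first argument gives the plain quotient wherever the latter
   is continuous, and the limit value at its singularities. *)
Definition cbinom (R : realType) (a b : R[i]) : R[i] :=
  lim ((cGamma (t + 1) / (cGamma (t - b + 1) * cGamma (b + 1)) : R[i]^o)
         @[t --> (a : R[i]^o)^']).

(* Newton's binomial series in f - 1: the power with constant term 1 of a series
   f with constant term 1; otherwise meaningless. *)
Definition pspow n (R : realType) (f : pseries n R[i]) (alpha : R[i]) :
    pseries n R[i] :=
  pssum (fun k : nat => psC n (cbinom alpha k%:R) * (f - 1) ^+ k).

(* The pair (a, i) stands for the element (a, i + 1) of {1..n} x {1, 2, ...}. *)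
Notation H n := ('I_n * nat)%type.
Definition lev n (h : H n) : nat := h.2.+1.

Definition KRD n (R : realType) (h k : H n) : R[i] :=
  - ((h.1 == k.1)%:R * ((lev h == lev k)%:R *+ 2
       - (lev h == (lev k).+1)%:R - ((lev h).+1 == lev k)%:R)).

Definition KRDinv n (R : realType) (h k : H n) : R[i] :=
  - ((h.1 == k.1)%:R * (minn (lev h) (lev k))%:R).

Definition GDinv n (R : realType) (G : H n -> H n -> R[i]) (h k : H n) : R[i] :=
  \sum_(l \in [set: H n]) G h l * KRDinv R l k.

(* D^{-1} is KRDinv, so KR_I only asserts that G D^{-1} is well-defined. *)
Definition KR_I n (R : realType) (G : H n -> H n -> R[i]) : Prop :=
  forall h k, finite_set [set l | G h l * KRDinv R l k != 0].

Definition KR_II n (R : realType) (G : H n -> H n -> R[i]) (g : 'M[int]_n) :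
    Prop :=
  (exists2 ord : rel (H n), wochoice.well_order ord &
     forall h k, ord h k -> GDinv G h k = (g h.1 k.1)%:~R * (lev h)%:R)
  /\ \det g != 0.

(* The second argument of Q is the unshifted level m >= 0. *)
Definition Qsystem_solution n (R : realType) (G : H n -> H n -> R[i])
    (Q : 'I_n -> nat -> pseries n R[i]) : Prop :=
  [/\ forall a m, Q a m 0 = 1,
      forall a, Q a 0%N = 1
    & forall h : H n, exists2 p : pseries n R[i],
        is_infprod (fun k : H n => pspow (Q k.1 (lev k)) (G h k)) p &
        Q h.1 (lev h) ^+ 2 = Q h.1 (lev h).-1 * Q h.1 (lev h).+1
          + psX R[i] h.1 ^+ lev h * Q h.1 (lev h) ^+ 2 * p].

Definition Qsystem_canonical n (R : realType)
    (Q : 'I_n -> nat -> pseries n R[i]) : Prop :=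
  exists2 F : H n -> H n -> pseries n R[i],
    forall h k, is_infprod
      (fun l : H n => pspow (Q l.1 (lev l)) (KRDinv R h k * KRD R k l)) (F h k) &
    forall h, is_infprod (F h) (Q h.1 (lev h)).

Definition Pvac n (R : realType) (G : H n -> H n -> R[i])
    (N : {fsfun H n -> nat with 0%N}) (h : H n) : R[i] :=
  - \sum_(k <- finsupp N) (N k)%:R * GDinv G k h.

Definition K0 n (R : realType) (G : H n -> H n -> R[i]) : pseries n R[i] :=
  pssum (fun N : {fsfun H n -> nat with 0%N} =>
    psC n (\prod_(h <- finsupp N) cbinom (Pvac G N h + (N h)%:R) (N h)%:R)
    * \prod_(h <- finsupp N) psX R[i] h.1 ^+ (lev h * N h)).

Notation lindex n := {ffun 'I_n -> int}.
Definition laurent (n : nat) (K : comNzRingType) := lindex n -> K.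

(* The convolution sum is meaningful when every coefficient of the product
   receives finitely many nonzero terms; this is the case for series supported
   in finitely many translates of one pointed cone, such as those below. *)
Definition lmul n (K : comNzRingType) (f g : laurent n K) : laurent n K :=
  fun e => \sum_(p \in [set p : lindex n * lindex n | p.1 + p.2 = e])
             f p.1 * g p.2.

Definition lmon n (K : comNzRingType) (e : lindex n) : laurent n K :=
  fun d => (d == e)%:R.

Definition lunit n (a : 'I_n) : lindex n := [ffun b => (b == a)%:Z].

Definition lderiv n (K : comNzRingType) (b : 'I_n) (f : laurent n K) :
    laurent n K :=
  fun e => (e b + 1)%:~R * f (e + lunit b).

Definition ldet n (K : comNzRingType) (M : 'I_n -> 'I_n -> laurent n K) :
    laurent n K :=
  fun e => \sum_(s : 'S_n)
    (-1) ^+ s * (\big[@lmul n K/lmon K 0]_(a < n) M a (s a)) e.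

(* exponent of the Laurent monomial y_a(x) = prod_b x_b^(- g_ab) *)
Definition yexp n (g : 'M[int]_n) (a : 'I_n) : lindex n :=
  [ffun b => - g a b].

Definition ysubst n (K : comNzRingType) (g : 'M[int]_n) (f : pseries n K) :
    laurent n K :=
  fun e => \sum_(d \in [set d : mindex n | \sum_a yexp g a *+ d a = e]) f d.

Definition Q1x n (R : realType) (g : 'M[int]_n)
    (Q : 'I_n -> nat -> pseries n R[i]) (a : 'I_n) : laurent n R[i] :=
  lmul (lmon R[i] (lunit a)) (ysubst g (Q a 1%N)).

Definition K0x n (R : realType) (G : H n -> H n -> R[i]) (g : 'M[int]_n) :
    laurent n R[i] :=
  ysubst g (K0 G).

(* Main.v *)
From mathcomp Require Import all_boot all_order all_algebra all_fingroup.
From mathcomp Require Import finmap complex ring lra zify.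
From mathcomp Require Import all_classical all_reals all_analysis.
Require Import Defs.

Set Implicit Arguments.
Unset Strict Implicit.
Unset Printing Implicit Defensive.

Import Order.TTheory GRing.Theory Num.Theory.
Import numFieldNormedType.Exports.
Import ComplexField.Normc.

Local Open Scope classical_set_scope.
Local Open Scope complex_scope.
Local Open Scope ring_scope.

(** Put [v_h = 1 - Q_(a,m-1) Q_(a,m+1) / Q_(a,m) ^ 2] for [h = (a, m)]. The Q-system
    and canonicity say that [Q_h] is the product of the [(1 - v_k) ^ (D^-1)_hk],
    and that the [v_h] solve the Lagrange system
    [v_h = w_h \prod_k (1 - v_k) ^ G'_hk] with [w_(a,m) = y_a ^ m]
    ([canonical_box], [vser_box]).

    Good's form of the Lagrange inversion formula ([lagrange_good]) evaluates the
    vacuum sum: [K0 * det M = 1] with [M = diag(1 - v) + diag(v) G']. It is proved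
    here by deforming [K0] to a family [K_nu], with exponents [nu_k] added to the
    vacancy numbers. By Pascal's rule [K_nu] satisfies the same recursion in [nu] as
    [\prod_k (1 - v_k) ^ (- nu_k)], and a solution with coefficients polynomial in
    [nu] is determined by its value at [nu = 0]; hence [K_nu] is [K0] times that
    product. Expanding the determinant, [K0 * det M] becomes a sum over [N] of
    determinants having [N] as a kernel vector, so only [N = 0] survives.

    For the Jacobian let [theta_b = x_b d/dx_b] and [S_kb = theta_b v_k / (1 - v_k)].
    Since [Q_(a,1)] is the product of the [1 / (1 - v_(a,m))], its logarithmic
    derivatives give [det (d (x_a Q_(a,1)) / d x_b)
    = \prod_h (1 - v_h)^-1 * det (1 + E S)], where [E] sums over the levels of one
    colour. Differentiating the Lagrange system gives
    [(M S)_(am,b) = - m g_ab v_(a,m)], so [M (1 + S E)] has the entries of [M] with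
    [G'] replaced by [G' - m g]. By condition (KR-II) that matrix is triangular for
    the well-order, with diagonal entries [1 - v_h]. Thus
    [det M * det (1 + S E) = \prod_h (1 - v_h)], and since
    [det (1 + S E) = det (1 + E S)] the Jacobian is [1 / det M], which is [K0]
    ([lagrange_series_jacobian]).

    There are infinitely many [h], but [v_(a,m)] is divisible by [y_a ^ m], so below
    degree [d] only the levels up to [d] matter: all these identities are proved as
    congruences [eq_below d] between finite expressions. Powers with complex
    exponents are handled through the remark that their coefficients are
    polynomials in the exponent, so that their laws follow from those of natural
    powers; in particular the Gamma quotients must be identified with the
    polynomial binomial coefficients ([cbinomE]). *)

(** * Euler's Gamma function and the binomial coefficient *)

Lemma normC_eq (R : realType) (z : R[i]) : `|z| = (normc z)%:C.
Proof. by []. Qed.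

Lemma normc_ge0 (R : realType) (z : R[i]) : 0 <= normc z.
Proof. by case: z => a b; exact: sqrtr_ge0. Qed.

Lemma normc_nat (R : realType) (k : nat) : normc (k%:R : R[i]) = k%:R.
Proof.
by apply: (@complexI R); rewrite -normC_eq normr_nat rmorph_nat.
Qed.

Lemma normc_le_ReIm (R : realType) (a b : R) :
  normc (a +i* b) <= `|a| + `|b|.
Proof.
rewrite /= -[leRHS]ger0_norm ?addr_ge0// -sqrtr_sqr ler_sqrt ?sqr_ge0//.
rewrite sqrrD !real_normK ?num_real// -addrA lerD2l lerDr.
by rewrite mulrn_wge0// mulr_ge0.
Qed.

Lemma ReIm_le_normc (R : realType) (a b : R) :
  `|a| <= normc (a +i* b) /\ `|b| <= normc (a +i* b).
Proof.
rewrite /= -!sqrtr_sqr !ler_sqrt ?addr_ge0 ?sqr_ge0//.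
by rewrite lerDl lerDr !sqr_ge0.
Qed.

Lemma cvg_normc (R : realType) (P : nat -> R[i]) (l : R[i]) :
  (forall e : R, 0 < e -> \forall k \near \oo, normc (l - P k) < e) ->
  (P : nat -> R[i]^o) @ \oo --> (l : R[i]^o).
Proof.
move=> Pl; apply/cvgrPdist_lt => eps.
case: eps => e im; rewrite ltcE /= => /andP[/eqP -> e0].
have := Pl _ e0; apply: filterS => k Pk.
by rewrite normC_eq ltcE /= eqxx /=.
Qed.

(** The criterion of Cauchy, applied to the real and the imaginary part. *)
Lemma cvg_slow_telescope (R : realType) (P : nat -> R[i]) (B : R) :
  (\forall M \near \oo, forall m, normc (P (M + m)%N - P M) <= B / M%:R) ->
  exists l : R[i], (P : nat -> R[i]^o) @ \oo --> (l : R[i]^o).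
Proof.
move=> PB.
have small e : 0 < e -> \forall M \near \oo, forall m,
    normc (P (M + m)%N - P M) < e.
  move=> e0; near=> M => m.
  apply: le_lt_trans (_ : B / M%:R < e); first exact: (near PB).
  have M0 : 0 < M%:R :> R by rewrite ltr0n; near: M; exists 1%N.
  rewrite ltr_pdivrMr// mulrC -ltr_pdivrMr//.
  by near: M; exact: nbhs_infty_gtr.
have cvgf (f : R[i] -> R) : (forall z w, `|f z - f w| <= normc (z - w)) ->
    cvgn (f \o P).
  move=> fle; apply: cauchy_cvg; apply: cauchy_exP => e e0.
  have [N _ HN] := small _ e0.
  exists (f (P N)); exists N => // k /= Nk.
  rewrite -ball_normE /= -(subnKC Nk).
  rewrite distrC; apply: le_lt_trans (fle _ _) _.
  exact: (HN N (leqnn N) (k - N)%N).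
have Rle (z w : R[i]) : `|complex.Re z - complex.Re w| <= normc (z - w).
  by case: z w => a b [c d]; have [] := ReIm_le_normc (a - c) (b - d).
have Ile (z w : R[i]) : `|complex.Im z - complex.Im w| <= normc (z - w).
  by case: z w => a b [c d]; have [] := ReIm_le_normc (a - c) (b - d).
have Re_cv := cvgf _ Rle; have Im_cv := cvgf _ Ile.
exists (limn (@complex.Re R \o P) +i* limn (@complex.Im R \o P)).
apply: cvg_normc => e e0.
have /cvgrPdist_lt/(_ (e / 2)) H1 := Re_cv.
have /cvgrPdist_lt/(_ (e / 2)) H2 := Im_cv.
near=> k.
have h1 : `|limn (@complex.Re R \o P) - complex.Re (P k)| < e / 2.
  by near: k; apply: H1; rewrite divr_gt0.
have h2 : `|limn (@complex.Im R \o P) - complex.Im (P k)| < e / 2.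
  by near: k; apply: H2; rewrite divr_gt0.
move: h1 h2; case: (P k) => a b /= h1 h2.
apply: le_lt_trans (normc_le_ReIm _ _) _.
by rewrite (splitr e) ltrD.
Unshelve. all: by end_near. Qed.

(** A sequence whose relative increments are dominated by [c / n (n + 1)] stays
    within a factor of its late values, so it converges, and not to [0]: this is
    how Euler's product defines a nonvanishing function. *)
Lemma cvg_relative_increments (R : realType) (P : nat -> R[i]) (c : R)
    (N0 : nat) : 0 <= c ->
  (forall k, (N0 <= k)%N -> P k != 0) ->
  (forall k, (N0 <= k)%N ->
     normc (P k.+1 - P k) <= c * (k%:R^-1 - k.+1%:R^-1) * normc (P k)) ->
  exists2 l : R[i], l != 0 & (P : nat -> R[i]^o) @ \oo --> (l : R[i]^o).
Proof.
move=> c0 Pn0 Pc.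
have step M : (N0 <= M)%N -> (0 < M)%N -> 4 * c <= M%:R -> forall m,
    normc (P (M + m)%N - P M)
      <= 2 * c * (M%:R^-1 - (M + m)%:R^-1) * normc (P M).
  move=> NM M0 cM; elim=> [|m IH].
    by rewrite addn0 !subrr normc0 mulr0 mul0r.
  have Mm0 : 0 < (M + m)%:R :> R by rewrite ltr0n addn_gt0 M0.
  have Mm1 : 0 < (M + m).+1%:R :> R by rewrite ltr0n.
  have M0r : 0 < M%:R :> R by rewrite ltr0n.
  set a := normc (P M) in IH *.
  have a0 : 0 <= a by exact: normc_ge0.
  have le2 : normc (P (M + m)%N) <= 2 * a.
    have -> : P (M + m)%N = P M + (P (M + m)%N - P M) by rewrite addrC subrK.
    apply: le_trans (le_normcD _ _) _; rewrite -/a.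
    suff : normc (P (M + m)%N - P M) <= a by lra.
    apply: le_trans IH _; rewrite -[leRHS]mul1r ler_wpM2r//.
    have i0 : 0 < (M + m)%:R^-1 :> R by rewrite invr_gt0.
    have : c * M%:R^-1 <= 4^-1.
      by rewrite ler_pdivrMr//; move: cM; lra.
    have := mulr_ge0 c0 (ltW i0); lra.
  have := Pc (M + m)%N (leq_trans NM (leq_addr _ _)).
  rewrite -addnS.
  have -> : P (M + m.+1)%N - P M =
      (P (M + m.+1)%N - P (M + m)%N) + (P (M + m)%N - P M).
    by rewrite addrA subrK.
  move=> h; apply: le_trans (le_normcD _ _) _.
  have d0 : 0 <= (M + m)%:R^-1 - (M + m.+1)%:R^-1 :> R.
    by rewrite subr_ge0 lef_pV2 ?posrE// ?addnS// ler_nat.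
  have : c * ((M + m)%:R^-1 - (M + m.+1)%:R^-1) * normc (P (M + m)%N)
      <= c * ((M + m)%:R^-1 - (M + m.+1)%:R^-1) * (2 * a).
    by rewrite ler_wpM2l// mulr_ge0.
  move: h IH; lra.
have [N [N1 N2 N3]] : exists N, [/\ (N0 <= N)%N, (0 < N)%N & 4 * c <= N%:R].
  pose N := (maxn N0 (Num.bound (4 * c))).
  have hN : 4 * c <= N.+1%:R.
    apply/ltW/(lt_le_trans (archi_boundP _)); first by rewrite mulr_ge0.
    by rewrite ler_nat /N; lia.
  by exists N.+1; split=> //; rewrite /N; lia.
have stepN k : (N <= k)%N ->
    normc (P k - P N) <= 2^-1 * normc (P N).
  move=> Nk; rewrite -(subnKC Nk); apply: le_trans (step N N1 N2 N3 _) _.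
  rewrite ler_wpM2r ?normc_ge0//.
  have M0r : 0 < N%:R :> R by rewrite ltr0n.
  have i0 : 0 <= (N + (k - N))%:R^-1 :> R by rewrite invr_ge0.
  have : c * N%:R^-1 <= 4^-1.
    by rewrite ler_pdivrMr//; move: N3; lra.
  have := mulr_ge0 c0 i0; lra.
have PN0 : 0 < normc (P N).
  rewrite lt_neqAle normc_ge0 andbT eq_sym; apply/eqP => /eq0_normc.
  by apply/eqP/Pn0.
have [|l Pl] := @cvg_slow_telescope _ P (4 * c * normc (P N)); last first.
  exists l => //; apply/eqP => l0; rewrite l0 in Pl.
  move/cvgrPdist_lt: Pl => /(_ (4^-1 * normc (P N))%:C).
  have pos : 0 < (4^-1 * normc (P N))%:C.
    by rewrite ltcR mulr_gt0// invr_gt0.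
  move=> /(_ pos)[M _ HM].
  have := HM (maxn M N) (leq_maxl _ _); rewrite normC_eq ltcR sub0r normcN => h.
  have := stepN (maxn M N) (leq_maxr _ _).
  have := le_normcD (P N - P (maxn M N)) (P (maxn M N)).
  rewrite subrK -(normcN (P N - _)) opprB; move: h PN0; lra.
exists N => // M /= NM m.
have M0 : (0 < M)%N := leq_trans N2 NM.
apply: le_trans (step M (leq_trans N1 NM) M0 _ m) _.
  by apply: le_trans N3 _; rewrite ler_nat.
have h2 : normc (P M) <= 2 * normc (P N).
  have := le_normcD (P M - P N) (P N); rewrite subrK => h.
  by have := stepN M NM; move: h PN0; lra.
have M0r : 0 < M%:R^-1 :> R by rewrite invr_gt0 ltr0n.
have i0 : 0 <= (M + m)%:R^-1 :> R by rewrite invr_ge0.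
have -> : 4 * c * normc (P N) / M%:R = (2 * c / M%:R) * (2 * normc (P N)).
  by field; rewrite pnatr_eq0 -lt0n.
apply: ler_pM => //.
- rewrite !mulr_ge0// subr_ge0 lef_pV2 ?posrE ?ltr0n ?addn_gt0 ?M0//.
  by rewrite ler_nat leq_addr.
- exact: normc_ge0.
- rewrite ler_wpM2l ?mulr_ge0//; lra.
Qed.
Lemma mean_value_from0 (R : realType) (f df : R -> R) (C v : R) :
  (forall x : R, is_derive x 1 f (df x)) ->
  (forall x, `|x| <= `|v| -> `|df x| <= C) -> `|f v - f 0| <= C * `|v|.
Proof.
move=> Hf Hd.
have cf : continuous f.
  by move=> x; apply/differentiable_continuous/derivable1_diffP.
have [v0|/ltW v0] := leP 0 v.
  have [c + ->] :=
      MVT_segment v0 (fun x _ => Hf x) (continuous_subspaceT cf).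
  rewrite in_itv /= => /andP[c0 cv]; rewrite normrM subr0 ler_wpM2r//.
  by apply: Hd; rewrite !ger0_norm.
have [c + E] := MVT_segment v0 (fun x _ => Hf x) (continuous_subspaceT cf).
rewrite in_itv /= => /andP[cv c0].
rewrite distrC E normrM sub0r normrN ler_wpM2r//.
by apply: Hd; rewrite !ler0_norm// lerN2.
Qed.

Lemma normr_sin_le (R : realType) (v : R) : `|sin v| <= `|v|.
Proof.
have := @mean_value_from0 R sin cos 1 v.
by rewrite sin0 subr0 mul1r; apply=> // x _; exact: cos_max.
Qed.

Lemma normr_cosB1_le (R : realType) (v : R) : `|cos v - 1| <= v ^+ 2.
Proof.
have := @mean_value_from0 R cos (fun x => - sin x) `|v| v.
rewrite cos0 -expr2 real_normK ?num_real//; apply=> // x xv.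
by rewrite normrN (le_trans (normr_sin_le _)).
Qed.

Lemma normr_sinBid_le (R : realType) (v : R) : `|sin v - v| <= `|v| * v ^+ 2.
Proof.
have := @mean_value_from0 R (fun x => sin x - x) (fun x => cos x - 1)
  (v ^+ 2) v.
rewrite sin0 !subr0 mulrC; apply=> x xv.
apply: le_trans (normr_cosB1_le _) _.
rewrite -(real_normK (num_real x)) -(real_normK (num_real v)).
by rewrite ler_sqr ?nnegrE.
Qed.

Lemma expR_near0 (R : realType) (u : R) : `|u| <= 2^-1 ->
  1 + u <= expR u <= 1 + u + 2 * u ^+ 2.
Proof.
move=> /ler_normlP[u1 u2]; rewrite expR_ge1Dx /=.
have h : expR u * (1 - u) <= 1.
  rewrite -[leRHS](expRxMexpNx_1 u) ler_wpM2l ?expR_ge0//; exact: expR_ge1Dx.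
have e0 := expR_gt0 u.
have h2 : 1 <= (1 + u + 2 * u ^+ 2) * (1 - u).
  have : 0 <= u ^+ 2 * (1 - 2 * u) by rewrite mulr_ge0 ?sqr_ge0//; lra.
  lra.
rewrite -(@ler_pM2r _ (1 - u)); last by lra.
exact: le_trans h h2.
Qed.

(** The error of the first-order expansion of the exponential is quadratic; the
    constant is not optimal. *)
Lemma cexp_near0 (R : realType) (u v : R) : `|u| <= 2^-1 -> `|v| <= 2^-1 ->
  normc (cexp (u +i* v) - 1 - (u +i* v)) <= 6 * (u ^+ 2 + v ^+ 2).
Proof.
move=> u2 v2.
have -> : cexp (u +i* v) - 1 - (u +i* v)
    = (expR u * cos v - 1 - u) +i* (expR u * sin v - v).
  by apply/eqP; rewrite eq_complex /= !mul0r !subr0 !addr0 !eqxx.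
apply: le_trans (normc_le_ReIm _ _) _.
have /andP[e1 e2] := expR_near0 u2.
have c1 := normr_cosB1_le v; have s1 := normr_sinBid_le v.
have /ler_normlP[u3 u4] := u2; have /ler_normlP[v3 v4] := v2.
have eb : `|expR u - 1 - u| <= 2 * u ^+ 2 by apply/ler_normlP; split; lra.
have e3 : expR u <= 2 by nra.
have e4 : `|expR u - 1| <= 2 * `|u|.
  have -> : expR u - 1 = (expR u - 1 - u) + u by ring.
  apply: le_trans (ler_normD _ _) _.
  have : u ^+ 2 <= 2^-1 * `|u|.
    by rewrite -(real_normK (num_real u)) expr2 ler_wpM2r.
  lra.
have s2 : `|sin v - v| <= 2^-1 * v ^+ 2.
  by apply: le_trans s1 _; rewrite ler_wpM2r ?sqr_ge0.
have -> : expR u * cos v - 1 - u = expR u * (cos v - 1) + (expR u - 1 - u).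
  by ring.
have -> : expR u * sin v - v = expR u * (sin v - v) + v * (expR u - 1).
  by ring.
have hA : `|expR u * (cos v - 1)| <= 2 * v ^+ 2.
  by rewrite normrM (ger0_norm (expR_ge0 _)) ler_pM// expR_ge0.
have hB : `|expR u * (sin v - v)| <= v ^+ 2.
  have -> : v ^+ 2 = 2 * (2^-1 * v ^+ 2) by field.
  by rewrite normrM (ger0_norm (expR_ge0 _)) ler_pM// expR_ge0.
have hC : `|v * (expR u - 1)| <= u ^+ 2 + v ^+ 2.
  rewrite normrM.
  have h1 : `|v| * `|expR u - 1| <= `|v| * (2 * `|u|) by rewrite ler_wpM2l.
  have h2 : 0 <= (`|u| - `|v|) ^+ 2 by rewrite sqr_ge0.
  move: h1 h2; rewrite -(real_normK (num_real u)) -(real_normK (num_real v)).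
  lra.
have := ler_normD (expR u * (cos v - 1)) (expR u - 1 - u).
have := ler_normD (expR u * (sin v - v)) (v * (expR u - 1)).
have := sqr_ge0 u; have := sqr_ge0 v; lra.
Qed.

Lemma ln_succ_bounds (R : realType) (k : nat) : (0 < k)%N ->
  k.+1%:R^-1 <= (ln k.+1%:R : R) - ln k%:R <= k%:R^-1.
Proof.
move=> k0; have kr : 0 < k%:R :> R by rewrite ltr0n.
have k1r : 0 < k.+1%:R :> R by rewrite ltr0n.
rewrite -ln_div ?posrE//; apply/andP; split; last first.
  have -> : k.+1%:R / k%:R = 1 + k%:R^-1 :> R.
    by rewrite -natr1 mulrDl divff ?mul1r// gt_eqF.
  by apply: le_ln1Dx; apply: lt_trans (_ : 0 < _); rewrite ?ltrN10 ?invr_gt0.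
rewrite -lerN2 -lnV ?posrE ?divr_gt0// invf_div.
have -> : k%:R / k.+1%:R = 1 + - k.+1%:R^-1 :> R.
  by rewrite -[k%:R](addrK 1) natr1 mulrBl divff ?mul1r// gt_eqF.
apply: le_ln1Dx; rewrite ltrN2 invf_lt1// ltr1n ltnS//.
Qed.

Lemma cexpD (R : realType) (z w : R[i]) : cexp (z + w) = cexp z * cexp w.
Proof.
case: z w => a b [c d]; apply/eqP; rewrite eq_complex /= expRD cosD sinD.
by apply/andP; split; apply/eqP; ring.
Qed.

Lemma cexp_real (R : realType) (x : R) : cexp x%:C = (expR x)%:C.
Proof.
by apply/eqP; rewrite eq_complex /= cos0 sin0 !mulr1 !mulr0 subr0 addr0 !eqxx.
Qed.

Lemma cexp_neq0 (R : realType) (z : R[i]) : cexp z != 0.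
Proof.
apply/eqP => z0; have := cexpD z (- z); rewrite z0 mul0r subrr.
rewrite -[0](rmorph0 (real_complex R)) cexp_real expR0 rmorph0.
by move/eqP; rewrite rmorph1 oner_eq0.
Qed.
(** Euler's product approximating the Gamma function. *)
Definition euler_gamma (R : realType) (z : R[i]) (k : nat) : R[i] :=
  cexp (z * (ln k%:R)%:C) * (k`!)%:R / \prod_(j < k.+1) (z + j%:R).

Definition nonpole (R : realType) (z : R[i]) := forall j : nat, z + j%:R != 0.

Lemma euler_gamma_neq0 (R : realType) (z : R[i]) k :
  nonpole z -> euler_gamma z k != 0.
Proof.
move=> zn; rewrite /euler_gamma mulf_neq0//; last first.
  by rewrite invr_eq0; apply/prodf_neq0 => j _.
by rewrite mulf_neq0 ?cexp_neq0// pnatr_eq0 -lt0n fact_gt0.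
Qed.

Lemma euler_gammaS (R : realType) (z : R[i]) k : nonpole z ->
  euler_gamma z k.+1 = euler_gamma z k *
    (cexp (z * (ln k.+1%:R - ln k%:R)%:C) * k.+1%:R / (z + k.+1%:R)).
Proof.
move=> zn; rewrite /euler_gamma big_ord_recr /= factS natrM.
have -> : z * (ln k.+1%:R)%:C
    = z * (ln k%:R)%:C + z * (ln k.+1%:R - ln k%:R : R)%:C.
  by rewrite -mulrDr -rmorphD /= addrC subrK.
rewrite cexpD; field.
by rewrite nat1r zn; apply/prodf_neq0 => j _.
Qed.

(** The increment is [O(1 / k^2)] because [(1 + 1 / k)^z = 1 + z / k + O(1 / k^2)]
    cancels the factor [1 + z / k] to first order. *)
Lemma cvg_euler_gamma (R : realType) (z : R[i]) : nonpole z ->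
  exists2 l : R[i], l != 0 & (euler_gamma z : nat -> R[i]^o) @ \oo --> (l : R[i]^o).
Proof.
move=> zn; set a := normc z.
have a0 : 0 <= a := normc_ge0 z.
(* From [2 |z|] on, the denominator [z + k + 1] is at least [(k + 1) / 2]. *)
pose N0 := (Num.bound (2 * a)).+1.
have hN0 k : (N0 <= k)%N -> [/\ (0 < k)%N & 2 * a <= k%:R].
  move=> h; split; first exact: leq_trans h.
  apply/ltW/(lt_le_trans (archi_boundP _)); first by rewrite mulr_ge0.
  by rewrite ler_nat ltnW.
pose c := 4 * (12 * a ^+ 2 + a).
have c0 : 0 <= c by rewrite mulr_ge0// addr_ge0// mulr_ge0// sqr_ge0.
apply: (@cvg_relative_increments _ _ c N0) => // [k _|k /hN0[k0 ak]].
  exact: euler_gamma_neq0.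
rewrite euler_gammaS// -{2}[euler_gamma z k]mulr1 -mulrBr normcM mulrC.
rewrite ler_wpM2r ?normc_ge0//.
have kr : 0 < k%:R :> R by rewrite ltr0n.
have k1r : 0 < k.+1%:R :> R by rewrite ltr0n.
set t := (ln _ - _); set e := cexp _.
have /andP[t1 t2] := ln_succ_bounds R k0; rewrite -/t in t1 t2.
have t0 : 0 < t by apply: lt_le_trans t1; rewrite invr_gt0.
have -> : e * k.+1%:R / (z + k.+1%:R) - 1 =
   (k.+1%:R * (e - 1 - z * t%:C) + z * (k.+1%:R * t%:C - 1)) / (z + k.+1%:R).
  by field; rewrite nat1r; apply: zn.
have hden : 2^-1 * k.+1%:R <= normc (z + k.+1%:R).
  have := le_normcD (z + k.+1%:R) (- z).
  rewrite (addrC z) addrK normcN normc_nat -/a => h.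
  by move: h ak; rewrite -natr1; lra.
have he : normc (e - 1 - z * t%:C) <= 6 * a ^+ 2 * t ^+ 2.
  have [uv n2] : `|complex.Re z * t| <= 2^-1 /\ `|complex.Im z * t| <= 2^-1.
    have [h1 h2] : `|complex.Re z| <= a /\ `|complex.Im z| <= a.
      by rewrite /a; case: (z) => x y; exact: ReIm_le_normc.
    have at2 : a * t <= 2^-1.
      apply: le_trans (ler_wpM2l a0 t2) _.
      by rewrite ler_pdivrMr//; lra.
    by rewrite !normrM (ger0_norm (ltW t0)); split; apply: le_trans at2;
      rewrite ler_wpM2r// ltW.
  have := cexp_near0 uv n2.
  have -> : (complex.Re z * t) +i* (complex.Im z * t) = z * t%:C.
    by case: (z) => x y; apply/eqP; rewrite eq_complex /= !mulr0 subr0 add0r !eqxx.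
  move=> h; apply: le_trans h _; rewrite -mulrA ler_wpM2l//.
  rewrite !exprMn -mulrDl ler_wpM2r ?sqr_ge0// /a.
  by case: (z) => x y /=; rewrite sqr_sqrtr// addr_ge0 ?sqr_ge0.
have ht : normc (k.+1%:R * t%:C - 1 : R[i]) <= k%:R^-1.
  have -> : k.+1%:R * t%:C - 1 = (k.+1%:R * t - 1) +i* 0 :> R[i].
    by rewrite complexr0 -(rmorph_nat (real_complex R)) -rmorphM
      -[X in _ - X](rmorph1 (real_complex R)) -rmorphB.
  apply: le_trans (normc_le_ReIm _ _) _; rewrite normr0 addr0 ger0_norm.
    rewrite lerBlDr; apply: le_trans (ler_wpM2l (ltW k1r) t2) _.
    by rewrite -natr1 mulrDl divff ?gt_eqF// mul1r addrC.
  by rewrite subr_ge0 -ler_pdivrMl// mulr1.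
rewrite normcM normcV ler_pdivrMr; last first.
  by apply: lt_le_trans hden; rewrite mulr_gt0 ?invr_gt0.
have -> : c * (k%:R^-1 - k.+1%:R^-1) = c * (k%:R^-1 * k.+1%:R^-1).
  by congr (_ * _); rewrite -natr1; field; rewrite natr1 !gt_eqF.
have hx : 2^-1 * c * k%:R^-1 <=
    c * (k%:R^-1 * k.+1%:R^-1) * normc (z + k.+1%:R).
  have p0 : 0 <= c * (k%:R^-1 * k.+1%:R^-1) by rewrite (mulr_ge0 c0)// mulr_ge0 ?invr_ge0.
  apply: le_trans (ler_wpM2l p0 hden).
  rewrite le_eqVlt; apply/orP; left; apply/eqP; field.
  by rewrite nat1r !pnatr_eq0; case: (k) k0.
apply: le_trans hx; apply: le_trans (le_normcD _ _) _.
rewrite !normcM normc_nat -/a.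
have h1 : k.+1%:R * normc (e - 1 - z * t%:C) <= 12 * a ^+ 2 * k%:R^-1.
  apply: le_trans (ler_wpM2l (ltW k1r) he) _.
  have h2 : t ^+ 2 <= k%:R^-1 ^+ 2 by rewrite ler_sqr ?nnegrE ?invr_ge0 ?(ltW t0) ?(ltW kr).
  have h3 : k.+1%:R <= 2 * k%:R :> R.
    by rewrite -natr1; have : 1 <= k%:R :> R; [rewrite ler1n|lra].
  have -> : 12 * a ^+ 2 * k%:R^-1 = 2 * k%:R * (6 * a ^+ 2 * k%:R^-1 ^+ 2).
    by field; rewrite gt_eqF.
  have q0 : 0 <= 6 * a ^+ 2 by rewrite mulr_ge0 ?sqr_ge0.
  by apply: ler_pM => //; [exact: mulr_ge0 q0 (sqr_ge0 _)|
    exact: ler_wpM2l].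
have h4 := ler_wpM2l a0 ht.
rewrite /c; set A := _ * normc _ in h1 *; set B := _ * normc _ in h4 *.
set K := k%:R^-1 in h1 h4 *.
have ki0 : 0 <= K by rewrite invr_ge0 ltW.
have := mulr_ge0 (sqr_ge0 a) ki0; have := mulr_ge0 a0 ki0.
by move: h1 h4; lra.
Qed.

Lemma euler_gammaD1 (R : realType) (z : R[i]) k : nonpole z -> nonpole (z + 1) ->
  (0 < k)%N ->
  euler_gamma (z + 1) k = z * (k%:R / (z + 1 + k%:R)) * euler_gamma z k.
Proof.
move=> zn z1n k0; rewrite /euler_gamma mulrDl mul1r cexpD cexp_real.
rewrite lnK ?posrE ?ltr0n// rmorph_nat.
have E : \prod_(j < k.+1) (z + 1 + j%:R) =
    (\prod_(j < k.+1) (z + j%:R)) * (z + 1 + k%:R) / z.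
  rewrite big_ord_recr [in RHS]big_ord_recl /= addr0.
  rewrite (eq_bigr (fun j : 'I_k => z + (bump 0 j)%:R)) => [|j _].
    by field; have := zn 0%N; rewrite addr0.
  by rewrite /bump add1n -nat1r addrA.
have z0 : z != 0 by have := zn 0%N; rewrite addr0.
rewrite E; field.
by rewrite z0 z1n andbT andbT; apply/prodf_neq0 => j _.
Qed.

Lemma cvg_nat_over_shift (R : realType) (w : R[i]) :
  ((fun k : nat => k%:R / (w + k%:R)) : nat -> R[i]^o) @ \oo --> (1 : R[i]^o).
Proof.
apply: cvg_normc => e e0; set a := normc w.
have a0 : 0 <= a := normc_ge0 w.
near=> k.
have ka : a / e + a < k%:R.
  by near: k; exact: nbhs_infty_gtr.
have kp : 0 < k%:R - a.
  by rewrite subr_gt0; apply: le_lt_trans ka; rewrite lerDr divr_ge0// ltW.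
have hd : k%:R - a <= normc (w + k%:R).
  have := le_normcD (w + k%:R) (- w).
  by rewrite (addrC w) addrK normcN normc_nat -/a; lra.
have wk : w + k%:R != 0.
  by apply/eqP => w0; move: hd; rewrite w0 normc0; lra.
have -> : 1 - k%:R / (w + k%:R) = w / (w + k%:R) by field.
rewrite normcM normcV -/a ltr_pdivrMr; last exact: lt_le_trans kp hd.
apply: lt_le_trans (_ : e * (k%:R - a) <= _); last by rewrite ler_wpM2l// ltW.
by rewrite mulrC -ltr_pdivrMr//; lra.
Unshelve. all: by end_near. Qed.

Lemma cGamma_cvg (R : realType) (z l : R[i]) :
  (euler_gamma z : nat -> R[i]^o) @ \oo --> (l : R[i]^o) -> cGamma z = l.
Proof.
move=> zl; rewrite /cGamma.
exact: (@cvg_lim (R[i]^o) (@norm_hausdorff _ (R[i]^o)) _ _ _ _ _ zl).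
Qed.

Lemma cGamma_neq0 (R : realType) (z : R[i]) : nonpole z -> cGamma z != 0.
Proof. by move=> /cvg_euler_gamma[l l0 /cGamma_cvg->]. Qed.

Lemma cGammaD1 (R : realType) (z : R[i]) : nonpole z ->
  cGamma (z + 1) = z * cGamma z.
Proof.
move=> zn; have z1n : nonpole (z + 1).
  by move=> j; rewrite -addrA nat1r.
have [l l0 zl] := cvg_euler_gamma zn; rewrite (cGamma_cvg zl).
apply: cGamma_cvg.
have zl1 : ((fun k => z * (k%:R / (z + 1 + k%:R)) * euler_gamma z k)
    : nat -> R[i]^o) @ \oo --> (z * 1 * l : R[i]^o).
  apply: (@cvgM R[i]); last exact: zl.
  by apply: (@cvgM R[i]); [exact: cvg_cst|exact: cvg_nat_over_shift].
rewrite mulr1 in zl1.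
apply: cvg_trans zl1; apply: near_eq_cvg.
by exists 1%N => // k /= k1; rewrite euler_gammaD1.
Qed.

Lemma cGamma1 (R : realType) : cGamma (1 : R[i]) = 1.
Proof.
apply: cGamma_cvg; apply: cvg_trans (@cvg_nat_over_shift R 1).
apply: near_eq_cvg; exists 1%N => // k /= k1.
rewrite /euler_gamma mul1r cexp_real lnK ?posrE ?ltr0n// rmorph_nat.
have -> : \prod_(j < k.+1) (1 + j%:R) = (k.+1`!)%:R :> R[i].
  elim: k {k1} => [|k IH]; first by rewrite big_ord1 addr0.
  by rewrite big_ord_recr /= IH nat1r -natrM mulnC -factS.
rewrite factS natrM -nat1r; field.
by rewrite nat1r !pnatr_eq0 /= -lt0n fact_gt0.
Qed.

Lemma cGamma_nat (R : realType) k : cGamma (k%:R + 1 : R[i]) = (k`!)%:R.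
Proof.
elim: k => [|k IH]; first by rewrite add0r cGamma1.
rewrite cGammaD1 => [|j]; last by rewrite -natrD pnatr_eq0.
by rewrite -natr1 IH natr1 -natrM -factS.
Qed.

Definition gbinom (K : fieldType) (a : K) (k : nat) : K :=
  (\prod_(j < k) (a - j%:R)) / (k`!)%:R.

Lemma cGamma_quotient (R : realType) (t : R[i]) k :
  nonpole (t - k%:R + 1) ->
  cGamma (t + 1) = (\prod_(j < k) (t - j%:R)) * cGamma (t - k%:R + 1).
Proof.
elim: k => [|k IH] tn; first by rewrite big_ord0 mul1r subr0.
have tk1 : t - k.+1%:R + 1 = t - k%:R by rewrite -natr1; ring.
rewrite tk1 in tn *.
rewrite IH => [|j]; last by rewrite -addrA nat1r.
by rewrite cGammaD1// big_ord_recr /= mulrA.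
Qed.

(** Near [a], but off the integers, the recursion of Gamma turns the quotient
    into a polynomial in its argument, whose limit is its value. *)
Lemma cbinomE (R : realType) (a : R[i]) k : cbinom a k%:R = gbinom a k.
Proof.
apply: (@cvg_lim (R[i]^o) (@norm_hausdorff _ (R[i]^o))).
have hpoly : ((fun t : R[i] => gbinom t k) : R[i]^o -> R[i]^o) t
    @[t --> (a : R[i]^o)^'] --> (gbinom a k : R[i]^o).
  apply: cvg_within_filter.
  rewrite /gbinom; apply: (@cvgM R[i]); last exact: cvg_cst.
  elim: k => [|k IH].
    rewrite big_ord0; apply: cvg_near_cst; near=> t.
    by rewrite big_ord0.
  rewrite big_ord_recr /=.
  have IH' : ((fun t => (\prod_(j < k) (t - j%:R)) * (t - k%:R))
      : R[i]^o -> R[i]^o) t @[t --> nbhs (a : R[i]^o)] -->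
      (((\prod_(j < k) (a - j%:R)) * (a - k%:R)) : R[i]^o).
    apply: (@cvgM R[i]); first exact: IH.
    by apply: (@cvgB R[i] R[i]^o); [exact: cvg_id|exact: cvg_cst].
  apply: cvg_trans IH'; apply: near_eq_cvg; near=> t.
  by rewrite big_ord_recr.
have np : \forall t \near (a : R[i]^o)^', nonpole (t - k%:R + 1).
  pose B := (Num.bound (normc a + 2 + k%:R)).+1.
  (* A pole [t] near [a] would be an integer of bounded size, so finitely many
     points have to be avoided. *)
  have avoid (w : R[i]) : \forall t \near (a : R[i]^o)^', t != w.
    have [->|aw] := eqVneq w a; first exact: nbhs_dnbhs_neq.
    apply: cvg_within; apply/nbhs_ballP; exists `|a - w|.
      by rewrite /= normr_gt0 subr_eq0 eq_sym.
    by move=> t; rewrite -ball_normE /=; case: eqVneq => // ->; rewrite ltxx.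
  have fin : \forall t \near (a : R[i]^o)^', forall j : 'I_B, t != k%:R - 1 - j%:R.
    by apply: filter_forall => j; exact: avoid.
  have nb : \forall t \near (a : R[i]^o)^', normc (t - a) < 1.
    apply: cvg_within; apply/nbhs_ballP; exists 1 => //= t.
    by rewrite -ball_normE /= normC_eq ltcE /= eqxx /= -normcN opprB.
  near=> t => j; apply/eqP => tj.
  have tE : t = k%:R - 1 - j%:R by rewrite -[LHS]subr0 -tj; ring.
  have t1 : normc (t - a) < 1 by near: t.
  have jB : (j < B)%N.
    rewrite ltnS -(ler_nat R) ltW//; apply: le_lt_trans (archi_boundP _).
      rewrite -(normc_nat R j).
      have -> : j%:R = k%:R + (- 1 + (- (t - a) - a)) by rewrite tE; ring.
      have := le_normcD k%:R (- 1 + (- (t - a) - a)).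
      have := le_normcD (- 1) (- (t - a) - a).
      have := le_normcD (- (t - a)) (- a).
      by rewrite normc_nat !normcN normc1; lra.
    by rewrite !addr_ge0// normc_ge0.
  have : forall j : 'I_B, t != k%:R - 1 - j%:R by near: t.
  by move=> /(_ (Ordinal jB)); rewrite tE eqxx.
apply: cvg_trans hpoly; apply: near_eq_cvg; near=> t.
have tn : nonpole (t - k%:R + 1) by near: t.
rewrite (cGamma_quotient tn) cGamma_nat /gbinom; field.
by rewrite cGamma_neq0 //= pnatr_eq0 -lt0n fact_gt0.
Unshelve. all: by end_near. Qed.

(** * Generalized binomial coefficients and polynomial functions *)

Section GBinom.
Variable K : numFieldType.
Implicit Types (a b c t : K) (k m : nat).

Lemma fact_neq0 k : (k`!)%:R != 0 :> K.
Proof. by rewrite pnatr_eq0 -lt0n fact_gt0. Qed.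

Lemma gbinom0 a : gbinom a 0 = 1.
Proof. by rewrite /gbinom big_ord0 fact0 divr1. Qed.

Lemma gbinom_absorb a k :
  gbinom (a + 1) k.+1 * k.+1%:R = (a + 1) * gbinom a k.
Proof.
rewrite /gbinom big_ord_recl /= subr0 factS natrM.
rewrite (eq_bigr (fun j : 'I_k => a - j%:R)) => [|j _].
  by field; rewrite fact_neq0 nat1r pnatr_eq0.
by rewrite /bump add1n -natr1; ring.
Qed.

Lemma gbinom_pascal a k : gbinom (a + 1) k.+1 = gbinom a k.+1 + gbinom a k.
Proof.
have k0 : k.+1%:R != 0 :> K by rewrite pnatr_eq0.
apply: (mulIf k0); rewrite gbinom_absorb [RHS]mulrDl.
have -> : gbinom a k.+1 * k.+1%:R = (a - k%:R) * gbinom a k.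
  rewrite /gbinom big_ord_recr /= factS natrM.
  by field; rewrite fact_neq0 nat1r pnatr_eq0.
by rewrite -natr1; ring.
Qed.

Lemma gbinom_nat m k : gbinom (m%:R : K) k = 'C(m, k)%:R.
Proof.
elim: m k => [|m IH] [|k]; rewrite ?gbinom0 ?bin0//.
  by rewrite bin0n /gbinom big_ord_recl subrr !mul0r.
by rewrite -natr1 gbinom_pascal !IH binS natrD.
Qed.

Definition polyfun (phi : K -> K) := exists p : {poly K}, forall t, phi t = p.[t].

Lemma polyfun_cst c : polyfun (fun=> c).
Proof. by exists c%:P => t; rewrite hornerC. Qed.

Lemma polyfun_id : polyfun id.
Proof. by exists 'X => t; rewrite hornerX. Qed.

Lemma polyfunD f g : polyfun f -> polyfun g -> polyfun (fun t => f t + g t).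
Proof. by move=> [p fp] [q gq]; exists (p + q) => t; rewrite hornerD fp gq. Qed.

Lemma polyfunN f : polyfun f -> polyfun (fun t => - f t).
Proof. by move=> [p fp]; exists (- p) => t; rewrite hornerN fp. Qed.

Lemma polyfunM f g : polyfun f -> polyfun g -> polyfun (fun t => f t * g t).
Proof. by move=> [p fp] [q gq]; exists (p * q) => t; rewrite hornerM fp gq. Qed.

Lemma polyfun_sum (I : Type) (r : seq I) (P : pred I) (F : I -> K -> K) :
  (forall i, polyfun (F i)) -> polyfun (fun t => \sum_(i <- r | P i) F i t).
Proof.
move=> Fp; elim: r => [|i r IH].
  have [p pE] := polyfun_cst 0.
  by exists p => t; rewrite big_nil -pE.
have [p pE] : polyfun (fun t => F i t + \sum_(j <- r | P j) F j t).
  exact: polyfunD.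
have [q qE] := IH.
by case Pi : (P i); [exists p|exists q] => t; rewrite big_cons Pi.
Qed.

Lemma polyfun_prod (I : Type) (r : seq I) (P : pred I) (F : I -> K -> K) :
  (forall i, polyfun (F i)) -> polyfun (fun t => \prod_(i <- r | P i) F i t).
Proof.
move=> Fp; elim: r => [|i r IH].
  have [p pE] := polyfun_cst 1.
  by exists p => t; rewrite big_nil -pE.
have [p pE] : polyfun (fun t => F i t * \prod_(j <- r | P j) F j t).
  exact: polyfunM.
have [q qE] := IH.
by case Pi : (P i); [exists p|exists q] => t; rewrite big_cons Pi.
Qed.

Lemma polyfun_gbinom f k : polyfun f -> polyfun (fun t => gbinom (f t) k).
Proof.
move=> fp; apply: polyfunM; last exact: polyfun_cst.
by apply: polyfun_prod => j; apply: polyfunD => //; exact: polyfun_cst.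
Qed.

Lemma eq_polyfun_nat f g : polyfun f -> polyfun g ->
  (forall k, f k%:R = g k%:R) -> f =1 g.
Proof.
move=> [p fp] [q gq] fg t; rewrite fp gq; congr (_.[t]).
apply/eqP; rewrite -subr_eq0; apply/eqP.
pose s := [seq k%:R : K | k <- iota 0 (size (p - q))].
apply: (@roots_geq_poly_eq0 _ _ s).
- by apply/allP => x /mapP[k _ ->]; rewrite rootE hornerD hornerN -fp -gq fg subrr.
- rewrite map_inj_uniq ?iota_uniq// => x y.
  by move/eqP; rewrite eqr_nat => /eqP.
- by rewrite size_map size_iota.
Qed.

Lemma polyfun_periodic f : polyfun f -> (forall t, f t = f (t - 1)) ->
  forall t, f t = f 0.
Proof.
move=> fp fper; apply: eq_polyfun_nat => //; first exact: polyfun_cst.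
elim=> // k IH; rewrite fper -natr1 addrK IH//.
Qed.

End GBinom.

(** * Formal power series up to a given degree *)

Section Pseries.
Variables (n : nat) (K : comNzRingType).
Local Notation ps := (pseries n K).
Implicit Types (f g h : ps) (e : mindex n) (d : nat).

Definition mdeg e : nat := \sum_a e a.

Lemma mdegD e1 e2 : mdeg (e1 + e2) = (mdeg e1 + mdeg e2)%N.
Proof. by rewrite /mdeg -big_split /=; apply: eq_bigr => a _; rewrite ffunE. Qed.

Lemma mdeg0 : mdeg 0 = 0%N.
Proof. by rewrite /mdeg big1 // => a _; rewrite ffunE. Qed.

Lemma mdeg_eq0 e : (mdeg e == 0%N) = (e == 0).
Proof.
apply/eqP/eqP => [|->]; last exact: mdeg0.
move=> e0; apply/ffunP => a; rewrite ffunE; apply/eqP; rewrite -leqn0 -e0.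
by rewrite /mdeg (bigD1 a)//= leq_addr.
Qed.

Lemma pscoef0 e : (0 : ps) e = 0. Proof. by []. Qed.
Lemma pscoefD f g e : (f + g) e = f e + g e. Proof. by []. Qed.
Lemma pscoefN f e : (- f) e = - f e. Proof. by []. Qed.
Lemma pscoefB f g e : (f - g) e = f e - g e. Proof. by []. Qed.
Lemma pscoef1 e : (1 : ps) e = (e == 0)%:R. Proof. by []. Qed.
Lemma pscoefM f g e : (f * g) e = \sum_(p <- mdec e) f p.1 * g p.2.
Proof. exact: psmulE. Qed.

Lemma pscoef_sum (I : Type) (r : seq I) (P : pred I) (F : I -> ps) e :
  (\sum_(i <- r | P i) F i) e = \sum_(i <- r | P i) F i e.
Proof. by apply: (big_morph (fun f : ps => f e)). Qed.

Lemma mdec0 : perm_eq (mdec (0 : mindex n)) [:: (0, 0)].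
Proof.
apply: uniq_perm; rewrite ?fset_uniq// => -[u v].
rewrite mem_mdec mem_seq1 /= xpair_eqE -!mdeg_eq0 mdegD addn_eq0.
by [].
Qed.

Lemma pscoefM0 f g : (f * g) 0 = f 0 * g 0.
Proof. by rewrite pscoefM (perm_big _ mdec0) big_seq1. Qed.

Lemma pscoef_monM e0 f e : (psmon K e0 * f) e =
  if [forall a, (e0 a <= e a)%N] then f [ffun a => (e a - e0 a)%N] else 0.
Proof.
rewrite pscoefM; case: ifPn => [/forallP le_e|ge_e].
  rewrite (bigD1_seq (e0, [ffun a => (e a - e0 a)%N])) ?fset_uniq//=; last first.
    by rewrite mem_mdec /=; apply/eqP/ffunP => a; rewrite !ffunE; exact: subnKC.
  rewrite eqxx mul1r big1_seq ?addr0// => -[u v] /=.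
  rewrite mem_mdec xpair_eqE /=; case: eqVneq => [->|_ _]; last by rewrite mul0r.
  move=> /andP[/eqP ve /eqP uve]; case: ve; apply/ffunP => a.
  by rewrite -uve !ffunE; apply/esym; exact: addKn.
rewrite big1_seq// => -[u v] /=; rewrite mem_mdec /= => /eqP uve.
case: eqVneq => [ue|]; last by rewrite mul0r.
case/negP: ge_e; apply/forallP => a.
by rewrite -uve ue ffunE leq_addr.
Qed.

Lemma psmonD e1 e2 : psmon K (e1 + e2) = psmon K e1 * psmon K e2 :> ps.
Proof.
apply: psP => e; rewrite pscoef_monM /=; case: ifPn => [/forallP le_e|ge_e].
  congr ((nat_of_bool _)%:R); apply/eqP/eqP => [-> |/ffunP E]; apply/ffunP => a.
    by rewrite !ffunE; exact: addKn.
  by rewrite ffunE -E ffunE; apply/esym; exact: subnKC.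
case: eqVneq => // E; case/negP: ge_e; apply/forallP => a.
by rewrite E ffunE leq_addr.
Qed.

Lemma psCE (c : K) f : psC n c * f = PSeries (fun e => c * f e).
Proof.
apply: psP => e; rewrite -[f in RHS]mul1r -[RHS]/(c * (1 * f) e) !pscoefM.
by rewrite big_distrr /=; apply: eq_bigr => p _; rewrite mulrA.
Qed.

Lemma pscoefCM (c : K) f e : (psC n c * f) e = c * f e.
Proof. by rewrite psCE. Qed.

Lemma psC1 : psC n (1 : K) = 1.
Proof. by apply: psP => e /=; rewrite mul1r. Qed.

Lemma psC_nat k : psC n (k%:R : K) = k%:R.
Proof.
elim: k => [|k IH]; apply: psP => e; first by rewrite /= mul0r.
by rewrite -!natr1 -IH /= mulrDl mul1r.
Qed.

Lemma psCM (x y : K) : psC n (x * y) = psC n x * psC n y.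
Proof. by apply: psP => e; rewrite pscoefCM /= mulrA. Qed.

Lemma psCN (x : K) : psC n (- x) = - psC n x.
Proof. by apply: psP => e; rewrite pscoefN /= mulNr. Qed.

Lemma psCD (x y : K) : psC n (x + y) = psC n x + psC n y.
Proof. by apply: psP => e; rewrite pscoefD /= mulrDl. Qed.

(** Congruence modulo the series of order at least [d]; equality in all degrees
    is approached through these congruences, in which infinite sums and products
    become finite. *)
Definition eq_below d f g := forall e, (mdeg e < d)%N -> f e = g e.

Lemma eq_below_refl d f : eq_below d f f. Proof. by []. Qed.
Lemma eq_below_sym d f g : eq_below d f g -> eq_below d g f.
Proof. by move=> fg e /fg. Qed.
Lemma eq_below_trans d f g h : eq_below d f g -> eq_below d g h -> eq_below d f h.
Proof. by move=> fg gh e ed; rewrite fg ?gh. Qed.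

Lemma eq_belowW d d' f g : (d' <= d)%N -> eq_below d f g -> eq_below d' f g.
Proof. by move=> dd fg e ed; apply: fg; apply: leq_trans dd. Qed.

Lemma eq_belowP f g : (forall d, eq_below d f g) -> f = g.
Proof. by move=> fg; apply: psP => e; apply: (fg (mdeg e).+1). Qed.

Lemma eq_belowD d f f' g g' : eq_below d f f' -> eq_below d g g' ->
  eq_below d (f + g) (f' + g').
Proof. by move=> ff gg e ed; rewrite !pscoefD ff ?gg. Qed.

Lemma eq_belowN d f f' : eq_below d f f' -> eq_below d (- f) (- f').
Proof. by move=> ff e ed; rewrite !pscoefN ff. Qed.

Lemma eq_belowM d f f' g g' : eq_below d f f' -> eq_below d g g' ->
  eq_below d (f * g) (f' * g').
Proof.
move=> ff gg e ed; rewrite !pscoefM; apply: eq_big_seq => -[u v].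
rewrite mem_mdec /= => /eqP uv; move: ed; rewrite -uv mdegD => ed.
by rewrite ff ?gg// (leq_ltn_trans _ ed) ?leq_addl ?leq_addr.
Qed.

Lemma eq_belowMr d f f' g : eq_below d f f' -> eq_below d (f * g) (f' * g).
Proof. by move=> ff; exact: eq_belowM. Qed.

Lemma eq_belowMl d f g g' : eq_below d g g' -> eq_below d (f * g) (f * g').
Proof. by move=> gg; exact: eq_belowM. Qed.

Lemma eq_below_sum d (I : Type) (r : seq I) (P : pred I) (F G : I -> ps) :
  (forall i, P i -> eq_below d (F i) (G i)) ->
  eq_below d (\sum_(i <- r | P i) F i) (\sum_(i <- r | P i) G i).
Proof.
by move=> FG; apply: big_ind2 => // f f' g g'; exact: eq_belowD.
Qed.

Lemma eq_below_prod d (I : Type) (r : seq I) (P : pred I) (F G : I -> ps) :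
  (forall i, P i -> eq_below d (F i) (G i)) ->
  eq_below d (\prod_(i <- r | P i) F i) (\prod_(i <- r | P i) G i).
Proof.
by move=> FG; apply: big_ind2 => // f f' g g'; exact: eq_belowM.
Qed.

Lemma eq_belowX d f g k : eq_below d f g -> eq_below d (f ^+ k) (g ^+ k).
Proof.
by move=> fg; elim: k => [|k IH]; rewrite ?expr0// !exprS; exact: eq_belowM.
Qed.

Lemma eq_below_det d m (A B : 'M[ps]_m) :
  (forall i j, eq_below d (A i j) (B i j)) -> eq_below d (\det A) (\det B).
Proof.
move=> AB; apply: eq_below_sum => s _; apply: eq_belowM => //.
exact: eq_below_prod.
Qed.

Lemma vanish_belowM d1 d2 f g : eq_below d1 f 0 -> eq_below d2 g 0 ->
  eq_below (d1 + d2) (f * g) 0.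
Proof.
move=> f0 g0 e ed; rewrite pscoefM big1_seq// => -[u v].
rewrite mem_mdec /= => /eqP uv; move: ed; rewrite -uv mdegD.
case: (ltnP (mdeg u) d1) => [/f0-> _|d1u ed]; first by rewrite mul0r.
rewrite (g0 v) ?mulr0// -(ltn_add2l d1); apply: leq_ltn_trans ed.
by rewrite leq_add2r.
Qed.

Lemma vanish_belowX f k : f 0 = 0 -> eq_below k (f ^+ k) 0.
Proof.
move=> f0; have f1 : eq_below 1 f 0.
  by move=> e; rewrite ltnS leqn0 mdeg_eq0 => /eqP ->.
by elim: k => [|k IH] //; rewrite exprS -add1n; exact: vanish_belowM.
Qed.

End Pseries.

(** * Powers with arbitrary exponents *)

Section Powers.
Variables (n : nat) (K : numFieldType).
Local Notation ps := (pseries n K).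
Implicit Types (f g : ps) (e : mindex n) (a b c t : K).

(** Newton's binomial series with polynomial binomial coefficients; the sum may
    stop at the degree of the coefficient because [f - 1] has no constant term. *)
Definition npow f a : ps :=
  PSeries (fun e => \sum_(k < (mdeg e).+1) gbinom a k * ((f - 1) ^+ k) e).

Definition psone f := f 0 = 1.

Lemma psone1 : psone 1. Proof. by rewrite /psone pscoef1 eqxx. Qed.

Lemma psoneM f g : psone f -> psone g -> psone (f * g).
Proof. by rewrite /psone pscoefM0 => -> ->; rewrite mulr1. Qed.

Lemma psone_prod (I : Type) (r : seq I) (P : pred I) (F : I -> ps) :
  (forall i, P i -> psone (F i)) -> psone (\prod_(i <- r | P i) F i).
Proof. by move=> F1; apply: big_ind => //; [exact: psone1|exact: psoneM]. Qed.

Lemma psone_npow f a : psone (npow f a).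
Proof.
rewrite /psone /npow /= mdeg0 big_ord_recl big_ord0 gbinom0 expr0 pscoef1 eqxx.
by rewrite mul1r addr0.
Qed.

Lemma npow_trunc f a e B : psone f -> (mdeg e < B)%N ->
  npow f a e = \sum_(k < B) gbinom a k * ((f - 1) ^+ k) e.
Proof.
move=> f1 eB; rewrite [LHS]/= -(subnKC eB) big_split_ord /=.
rewrite [X in _ = _ + X]big1 ?addr0// => k _.
rewrite (@vanish_belowX _ _ (f - 1) ((mdeg e).+1 + k)) ?mulr0//.
  by rewrite pscoefB f1 pscoef1 eqxx subrr.
by rewrite addSn ltnS leq_addr.
Qed.

Lemma npow_nat f k : psone f -> npow f k%:R = f ^+ k.
Proof.
move=> f1; apply: psP => e.
rewrite (@npow_trunc _ _ _ (k.+1 + (mdeg e))) ?leq_addl ?addSn ?ltnS ?leq_addl//.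
rewrite -[f in RHS](subrK 1) (addrC (f - 1)) exprDn pscoef_sum.
rewrite -addSn big_split_ord /= [X in _ + X = _]big1 ?addr0 => [|j _].
  apply: eq_bigr => j _; rewrite expr1n mul1r gbinom_nat -[in RHS]mulr_natl -psC_nat.
  by rewrite pscoefCM.
by rewrite gbinom_nat bin_small ?mul0r// addSn ltnS leq_addr.
Qed.

Lemma npow0 f : psone f -> npow f 0 = 1.
Proof. exact: (@npow_nat f 0). Qed.

Lemma npow_id f : psone f -> npow f 1 = f.
Proof. exact: (@npow_nat f 1). Qed.

Lemma eq_below_npow d f g a : eq_below d f g -> eq_below d (npow f a) (npow g a).
Proof.
move=> fg e ed; apply: eq_bigr => k _; congr (_ * _).
exact: (eq_belowX k (eq_belowD fg (@eq_below_refl _ _ d (- 1))) ed).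
Qed.

Definition pspoly (F : K -> ps) := forall e, polyfun (fun t => F t e).

Lemma pspoly_cst f : pspoly (fun=> f).
Proof. by move=> e; exact: polyfun_cst. Qed.

Lemma pspolyD F G : pspoly F -> pspoly G -> pspoly (fun t => F t + G t).
Proof. by move=> FP GP e; exact: polyfunD. Qed.

Lemma pspolyN F : pspoly F -> pspoly (fun t => - F t).
Proof. by move=> FP e; exact: polyfunN. Qed.

Lemma pspolyM F G : pspoly F -> pspoly G -> pspoly (fun t => F t * G t).
Proof.
move=> FP GP e.
have [p pE] : polyfun (fun t => \sum_(u <- mdec e) F t u.1 * G t u.2).
  by apply: polyfun_sum => u; exact: polyfunM.
by exists p => t; rewrite pscoefM -pE.
Qed.

Lemma pspolyX F k : pspoly F -> pspoly (fun t => F t ^+ k).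
Proof.
move=> FP; elim: k => [|k IH]; first exact: pspoly_cst.
by move=> e; have [p pE] := pspolyM FP IH e; exists p => t; rewrite exprS.
Qed.

Lemma pspoly_prod (I : Type) (r : seq I) (F : I -> K -> ps) :
  (forall i, pspoly (F i)) -> pspoly (fun t => \prod_(i <- r) F i t).
Proof.
move=> FP; elim: r => [|i r IH] e.
  by have [p pE] := pspoly_cst 1 e; exists p => t; rewrite big_nil.
by have [p pE] := pspolyM (FP i) IH e; exists p => t; rewrite big_cons.
Qed.

Lemma pspolyC phi : polyfun phi -> pspoly (fun t => psC n (phi t)).
Proof. by move=> phiP e; apply: polyfunM => //; exact: polyfun_cst. Qed.

Lemma pspoly_npow F phi : pspoly F -> polyfun phi ->
  pspoly (fun t => npow (F t) (phi t)).
Proof.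
move=> FP phiP e; apply: polyfun_sum => k; apply: polyfunM.
  exact: polyfun_gbinom.
by apply: pspolyX; apply: pspolyD => //; exact: pspoly_cst.
Qed.

(** The identities between powers are identities between polynomials in the
    exponents, so it is enough to check them for natural exponents. *)
Lemma eq_pspoly_nat F G : pspoly F -> pspoly G ->
  (forall k, F k%:R = G k%:R) -> forall t, F t = G t.
Proof.
move=> FP GP FG t; apply: psP => e.
by apply: (eq_polyfun_nat (FP e) (GP e)) => k; rewrite FG.
Qed.

Local Ltac pspoly_tac :=
  repeat first [exact: polyfun_id | exact: polyfun_cst | exact: pspoly_cst
    | apply: pspolyM | apply: pspoly_npow | apply: polyfunD | apply: polyfunM
    | apply: pspolyC].

Lemma npowD f a b : psone f -> npow f (a + b) = npow f a * npow f b.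
Proof.
move=> f1; move: b; apply: eq_pspoly_nat; [pspoly_tac..|] => k; move: a.
apply: eq_pspoly_nat; [pspoly_tac..|] => j.
by rewrite -natrD !npow_nat// exprD.
Qed.

Lemma npowMl f g a : psone f -> psone g ->
  npow (f * g) a = npow f a * npow g a.
Proof.
move=> f1 g1; move: a; apply: eq_pspoly_nat; [pspoly_tac..|] => k.
by rewrite !npow_nat ?exprMn//; exact: psoneM.
Qed.

Lemma npowM f a b : psone f -> npow (npow f a) b = npow f (a * b).
Proof.
move=> f1; move: b; apply: eq_pspoly_nat; [pspoly_tac..|] => k; move: a.
apply: eq_pspoly_nat; [pspoly_tac..|] => j.
rewrite (@npow_nat (npow _ _)); last exact: psone_npow.
by rewrite -natrM !npow_nat// exprM.
Qed.

Lemma npow1 a : npow 1 a = 1.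
Proof.
move: a; apply: eq_pspoly_nat; [pspoly_tac..|] => k.
by rewrite npow_nat ?expr1n//; exact: psone1.
Qed.

Lemma npowVr f : psone f -> f * npow f (- 1) = 1.
Proof.
by move=> f1; rewrite -[f in f * _]npow_id// -npowD// subrr npow0.
Qed.

Lemma npow_prod (I : Type) (r : seq I) (F : I -> ps) a :
  (forall i, psone (F i)) ->
  npow (\prod_(i <- r) F i) a = \prod_(i <- r) npow (F i) a.
Proof.
move=> F1; elim: r => [|i r IH]; first by rewrite !big_nil npow1.
by rewrite !big_cons npowMl ?IH//; exact: psone_prod.
Qed.

Lemma npow_sum (I : Type) (r : seq I) f (A : I -> K) : psone f ->
  npow f (\sum_(i <- r) A i) = \prod_(i <- r) npow f (A i).
Proof.
move=> f1; elim: r => [|i r IH]; first by rewrite !big_nil npow0.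
by rewrite !big_cons npowD ?IH.
Qed.

Lemma eq_below1_npow d f a : eq_below d f 1 -> eq_below d (npow f a) 1.
Proof. by move=> /(eq_below_npow a); rewrite npow1. Qed.

Section Theta.
Variable lam : mindex n -> K.
Hypothesis lamD : forall e1 e2, lam (e1 + e2) = lam e1 + lam e2.

(** The infinitesimal rescaling of the variables with weights [lam]: the
    derivation [x_b d/dx_b] of functions of [y(x)] has this form. *)
Definition theta f : ps := PSeries (fun e => lam e * f e).

Lemma thetaM f g : theta (f * g) = theta f * g + f * theta g.
Proof.
apply: psP => e; rewrite pscoefD -[LHS]/(lam e * (f * g) e) !pscoefM.
rewrite big_distrr -big_split /=; apply: eq_big_seq => p.
by rewrite mem_mdec => /eqP <-; rewrite lamD; ring.
Qed.

Lemma thetaD f g : theta (f + g) = theta f + theta g.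
Proof. by apply: psP => e; rewrite /= mulrDr. Qed.

Lemma theta1 : theta 1 = 0.
Proof.
have := thetaM 1 1; rewrite !mulr1 mul1r => /eqP.
by rewrite -[X in X == _]addr0 (inj_eq (addrI _)) => /eqP.
Qed.

Lemma thetaN f : theta (- f) = - theta f.
Proof. by apply: psP => e; rewrite /= mulrN. Qed.

Lemma eq_below_theta d f g : eq_below d f g -> eq_below d (theta f) (theta g).
Proof. by move=> fg e ed; rewrite /= fg. Qed.

Lemma pspoly_theta F : pspoly F -> pspoly (fun t => theta (F t)).
Proof. by move=> FP e; apply: polyfunM => //; exact: polyfun_cst. Qed.

Lemma theta_npow f a : psone f ->
  theta (npow f a) = npow f a * (psC n a * theta f * npow f (- 1)).
Proof.
move=> f1.
(* Cleared of the inverse power the claim is polynomial in [a], so that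
   natural exponents suffice. *)
suff E : f * theta (npow f a) = psC n a * npow f a * theta f.
  rewrite -[LHS]mul1r -(npowVr f1) -mulrA mulrCA E; ring.
move: a; apply: eq_pspoly_nat; first by apply: pspolyM; pspoly_tac;
  apply: pspoly_theta; pspoly_tac.
  by pspoly_tac.
elim=> [|k IH].
  by rewrite npow_nat// expr0 theta1 psC_nat mulr0 !mul0r.
move: IH; rewrite !npow_nat// exprS thetaM !psC_nat => IH.
by rewrite mulrDr mulrCA IH -natr1; ring.
Qed.

Lemma theta_mon e : theta (psmon K e) = psC n (lam e) * psmon K e.
Proof.
by apply: psP => e'; rewrite pscoefCM /=; case: eqVneq => [->|_]; rewrite ?mulr0.
Qed.

Lemma theta_prod_npow (I : Type) (r : seq I) (F : I -> ps) (A : I -> K) :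
  (forall i, psone (F i)) ->
  theta (\prod_(i <- r) npow (F i) (A i)) =
  \prod_(i <- r) npow (F i) (A i)
    * \sum_(i <- r) psC n (A i) * theta (F i) * npow (F i) (- 1).
Proof.
move=> F1; elim: r => [|i r IH]; first by rewrite !big_nil theta1 mulr0.
by rewrite !big_cons thetaM IH theta_npow//; ring.
Qed.

End Theta.
End Powers.

(** * Multivariable Lagrange inversion *)

Lemma mindexDI n (w : mindex n) : injective (fun e => e + w).
Proof.
move=> e e' /ffunP E; apply/ffunP => a; have := E a.
by rewrite !ffunE => /addIn.
Qed.

Section LagrangeGood.
Variables (n r : nat) (K : numFieldType).
Variable u : 'I_r -> mindex n.
Hypothesis u_gt0 : forall i, (0 < mdeg (u i))%N.
Variable A : 'I_r -> 'I_r -> K.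
Local Notation ps := (pseries n K).
Implicit Types (N : mindex r) (e : mindex n) (S : {set 'I_r}).
Implicit Types (nu : 'I_r -> K) (c : mindex r -> K).

Definition weight N : mindex n := \sum_i u i *+ N i.
Definition unit_index (i : 'I_r) : mindex r := [ffun j => nat_of_bool (j == i)].

Lemma weight0 : weight 0 = 0.
Proof. by rewrite /weight big1// => i _; rewrite ffunE mulr0n. Qed.

Lemma weightD N1 N2 : weight (N1 + N2) = weight N1 + weight N2.
Proof.
rewrite /weight -big_split; apply: eq_bigr => i _ /=.
by rewrite ffunE mulrnDr.
Qed.

Lemma weight_unit i : weight (unit_index i) = u i.
Proof.
rewrite /weight (bigD1 i)//= ffunE eqxx big1 ?addr0// => j /negPf ji.
by rewrite ffunE ji.
Qed.

Lemma leq_weight N i : (N i <= mdeg (weight N))%N.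
Proof.
rewrite /weight (bigD1 i)//= mdegD (leq_trans _ (leq_addr _ _))//.
elim: (N i) => [|k IH]//; rewrite mulrS mdegD.
by rewrite -add1n leq_add.
Qed.

Lemma finite_weight_fiber e : finite_set [set N | weight N = e].
Proof.
pose B := (mdeg e).+1.
pose h (p : {ffun 'I_r -> 'I_B}) : mindex r := [ffun i => val (p i)].
apply: (@sub_finite_set _ _ (h @` setT)); last first.
  exact/finite_image/finite_finset.
move=> N /= Ne.
have NB i : (N i < B)%N by rewrite ltnS -Ne leq_weight.
by exists [ffun i => Ordinal (NB i)] => //; apply/ffunP => i; rewrite !ffunE.
Qed.

Definition weight_fiber e := fset_set [set N | weight N = e].

Lemma mem_weight_fiber e N : (N \in weight_fiber e) = (weight N == e).
Proof.
rewrite /weight_fiber in_fset_set; last exact: finite_weight_fiber.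
by apply/idP/eqP => [/set_mem|pe]; [|apply/mem_set].
Qed.

(** The series [\sum_N c N * y^(weight N)], i.e. the power series in [r]
    variables with coefficients [c] evaluated at the monomials [y^(u i)]. *)
Definition wseries c : ps := PSeries (fun e => \sum_(N <- weight_fiber e) c N).

Lemma eq_wseries c c' : c =1 c' -> wseries c = wseries c'.
Proof. by move=> cc; apply: psP => e; apply: eq_bigr => N _. Qed.

Lemma wseriesB c c' : wseries (fun N => c N - c' N) = wseries c - wseries c'.
Proof. by apply: psP => e; rewrite pscoefB /= sumrB. Qed.

Lemma wseriesZ (x : K) c : wseries (fun N => x * c N) = psC n x * wseries c.
Proof. by apply: psP => e; rewrite pscoefCM /= mulr_sumr. Qed.

Lemma wseries_sum (I : Type) (s : seq I) (P : pred I) (F : I -> mindex r -> K) :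
  wseries (fun N => \sum_(i <- s | P i) F i N)
  = \sum_(i <- s | P i) wseries (F i).
Proof. by apply: psP => e; rewrite pscoef_sum /= exchange_big. Qed.

Lemma wseries_const c : (forall N, N != 0 -> c N = 0) ->
  wseries c = psC n (c 0).
Proof.
move=> c0; apply: psP => e /=; have [->|e0] := eqVneq e 0.
  rewrite mulr1 (bigD1_seq 0) ?fset_uniq ?mem_weight_fiber ?weight0//=.
  by rewrite big1 ?addr0.
rewrite mulr0 big1_seq// => N /=; rewrite mem_weight_fiber => /eqP Ne.
by apply: c0; apply: contraNneq e0 => N0; rewrite -Ne N0 weight0.
Qed.

Lemma wseries_shift i c c' :
  (forall N, N i = 0%N -> c' N = 0) -> (forall N, c' (N + unit_index i) = c N) ->
  psmon K (u i) * wseries c = wseries c'.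
Proof.
move=> c'0 c'S; apply: psP => e; rewrite pscoef_monM [in RHS]/=.
pose sh N := N + unit_index i.
have shI : injective sh by exact: mindexDI.
have shP N : N i != 0%N -> exists N', N = sh N'.
  move=> Ni; exists [ffun j => (N j - unit_index i j)%N].
  apply/ffunP => j; rewrite /sh !ffunE; apply/esym/subnK.
  by case: eqP => // ->; rewrite lt0n.
rewrite (bigID (fun N : mindex r => N i == 0%N)) /= [X in _ = X + _]big1 ?add0r; last first.
  by move=> N /eqP Ni; exact: c'0.
rewrite -[in RHS]big_filter; case: ifPn => [/forallP le_e|nle_e].
  have eE : e = [ffun a => (e a - u i a)%N] + u i.
    by apply/ffunP => a; rewrite !ffunE; apply/esym; exact: subnK.
  rewrite [RHS](perm_big [seq sh N | N <- weight_fiber [ffun a => (e a - u i a)%N]]).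
    by rewrite big_map; apply: eq_bigr => N _; rewrite c'S.
  apply: uniq_perm; rewrite ?filter_uniq ?map_inj_uniq ?fset_uniq//.
  move=> N; rewrite mem_filter mem_weight_fiber.
  apply/andP/mapP => [[/shP[N' ->] /eqP Ne]|[N' + ->]].
    exists N' => //; rewrite mem_weight_fiber; apply/eqP/(@mindexDI _ (u i)).
    by rewrite -eE -Ne /sh weightD weight_unit.
  rewrite mem_weight_fiber => /eqP N'e; split.
    rewrite /sh !ffunE eqxx -lt0n; exact: leq_addl.
  by rewrite /sh weightD N'e weight_unit -eE.
rewrite big1_seq// => N; rewrite mem_filter mem_weight_fiber.
move=> /andP[_ /andP[/shP[N' ->] /eqP Ne]]; case/negP: nle_e; apply/forallP => a.
by rewrite -Ne /sh weightD weight_unit ffunE leq_addl.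
Qed.

Local Open Scope set_scope.

(** For [nu = 0] this is the vacancy number of [N]. *)
Definition shifted_exponent nu N k : K := nu k - \sum_h (N h)%:R * A h k.

(** For [k] in [S] the binomial coefficient is lowered by one in both
    arguments; this inserts a factor [v_k]. *)
Definition lagrange_coef S nu N : K :=
  \prod_k (if k \in S
           then if N k is m.+1
                then gbinom (shifted_exponent nu N k + m%:R) m else 0
           else gbinom (shifted_exponent nu N k + (N k)%:R) (N k)).

Definition lagrange_series nu : ps := wseries (lagrange_coef finset.set0 nu).

Definition lower k nu : 'I_r -> K := fun j => nu j - (j == k)%:R.

(** Pascal's rule in the factor of index [k]: lowering [nu_k] by one gives the
    term of the rule that keeps the lower argument. *)
Lemma lagrange_coefU k S nu N : k \notin S ->
  lagrange_coef (k |: S) nu N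
  = lagrange_coef S nu N - lagrange_coef S (lower k nu) N.
Proof.
move=> kS; rewrite /lagrange_coef (bigD1 k)//= [in RHS](bigD1 k)//=.
rewrite [X in _ = _ - X](bigD1 k)//= finset.setU11 (negPf kS).
set X := \prod_(i | _) _; set Y := \prod_(i | _) _; set Z := \prod_(i | _) _.
have -> : X = Y by apply: eq_bigr => j /negPf jk; rewrite finset.in_setU1 jk.
have -> : Z = Y.
  apply: eq_bigr => j /negPf jk.
  by rewrite /shifted_exponent /lower jk subr0.
rewrite -mulrBl; congr (_ * _); rewrite /shifted_exponent /lower eqxx.
case: (N k) => [|m]; first by rewrite !gbinom0 subrr.
set s := \sum_h _.
have -> : nu k - s + m.+1%:R = (nu k - s + m%:R) + 1 by rewrite -natr1 addrA.
have -> : nu k - 1 - s + m.+1%:R = nu k - s + m%:R by rewrite -natr1; ring.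
by rewrite gbinom_pascal; ring.
Qed.

Lemma lagrange_coef_shift k nu N :
  lagrange_coef [set k] nu (N + unit_index k)
  = lagrange_coef finset.set0 (fun j => nu j - A k j) N.
Proof.
have E j : shifted_exponent nu (N + unit_index k) j
    = shifted_exponent (fun j => nu j - A k j) N j.
  rewrite /shifted_exponent -addrA -opprD; congr (_ - _).
  under eq_bigr do rewrite ffunE natrD mulrDl.
  rewrite big_split /= addrC; congr (_ + _).
  rewrite (bigD1 k)//= ffunE eqxx mul1r big1 ?addr0// => h /negPf hk.
  by rewrite ffunE hk mul0r.
apply: eq_bigr => j _; rewrite finset.in_set1 finset.in_set0 E.
case: eqVneq => [->|/negPf jk].
  by have -> : (N + unit_index k) k = (N k).+1
    by rewrite !ffunE eqxx; exact: addn1.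
by have -> : (N + unit_index k) j = N j by rewrite !ffunE jk; exact: addn0.
Qed.

(** Pascal's rule, summed against the monomials. *)
Lemma lagrange_series_pascal k nu :
  lagrange_series nu - lagrange_series (lower k nu)
  = psmon K (u k) * lagrange_series (fun j => nu j - A k j).
Proof.
rewrite -wseriesB; apply/esym/wseries_shift => N; last first.
  by rewrite -lagrange_coef_shift -(finset.setU0 [set k]) lagrange_coefU ?finset.in_set0.
move=> Nk; rewrite -lagrange_coefU ?finset.in_set0// finset.setU0 /lagrange_coef.
by rewrite (bigD1 k)//= finset.set11 Nk mul0r.
Qed.

Lemma polyfun_lagrange_series nu k e :
  polyfun (fun t => lagrange_series (fun j => nu j + t * (j == k)%:R) e).
Proof.
apply: polyfun_sum => N; apply: polyfun_prod => j; rewrite finset.in_set0.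
apply: polyfun_gbinom; rewrite /shifted_exponent.
do 2 (apply: polyfunD; [|exact: polyfun_cst]).
apply: polyfunD; first exact: polyfun_cst.
by apply: polyfunM; [exact: polyfun_id|exact: polyfun_cst].
Qed.

(** In the lowest degree that is not yet known to vanish the recursion says that
    the coefficient is periodic in each direction; being polynomial it is then
    constant, hence equal to its value at [nu = 0]. *)
Lemma pascal_unique d (F : ('I_r -> K) -> ps) :
  (forall nu k e, polyfun (fun t => F (fun j => nu j + t * (j == k)%:R) e)) ->
  (forall nu k, eq_below d (F nu - F (lower k nu))
     (psmon K (u k) * F (fun j => nu j - A k j))) ->
  eq_below d (F (fun=> 0)) 0 -> forall nu, eq_below d (F nu) 0.
Proof.
move=> Fpoly; elim: d => [|d IH] Frec F0 // nu e.
have {}IH : forall nu, eq_below d (F nu) 0.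
  by apply: IH => [nu' k|]; apply: eq_belowW (leqnSn d) _.
rewrite ltnS leq_eqVlt => /predU1P[ed|]; last exact: IH.
have step nu' k : F nu' e = F (lower k nu') e.
  apply/eqP; rewrite -subr_eq0 -pscoefN -pscoefD Frec ?ed//.
  rewrite pscoef_monM; case: ifPn => // /forallP le_e.
  rewrite IH// -ed.
  have eE : e = [ffun a => (e a - u k a)%N] + u k.
    by apply/ffunP => a; rewrite !ffunE; apply/esym; exact: subnK.
  by rewrite [X in (_ < mdeg X)%N]eE mdegD -[X in (X < _)%N]addn0 ltn_add2l.
have line nu' k : F nu' e = F (fun j => if j == k then 0 else nu' j) e.
  have per t : F (fun j => nu' j + t * (j == k)%:R) e
      = F (fun j => nu' j + (t - 1) * (j == k)%:R) e.
    rewrite (step _ k); congr (F _ e); apply/funext => j.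
    by rewrite /lower mulrBl mul1r addrA.
  have := polyfun_periodic (Fpoly nu' k e) per (- nu' k).
  have -> : (fun j => nu' j + 0 * (j == k)%:R) = nu'.
    by apply/funext => j; rewrite mul0r addr0.
  move=> <-; congr (F _ e); apply/funext => j; case: eqVneq => [->|_].
    by rewrite mulr1 subrr.
  by rewrite mulr0 addr0.
have zero (s : seq 'I_r) : F nu e = F (fun j => if j \in s then 0 else nu j) e.
  elim: s => [|k s ->]; first by congr (F _ e); apply/funext => j.
  rewrite (line _ k); congr (F _ e); apply/funext => j.
  by rewrite in_cons; case: eqP.
rewrite (zero (enum 'I_r)) -(F0 e) ?ed//; congr (F _ e); apply/funext => j.
by rewrite mem_enum.
Qed.

Variables (d : nat) (v : 'I_r -> ps).
Hypothesis v0 : forall i, v i 0 = 0.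
Hypothesis vE : forall i, eq_below d (v i)
  (psmon K (u i) * \prod_j npow (1 - v j) (A i j)).

(** The expected ratio of [lagrange_series nu] to [lagrange_series 0]. *)
Definition vpow nu : ps := \prod_j npow (1 - v j) (- nu j).

Lemma psone1B i : psone (1 - v i).
Proof. by rewrite /psone pscoefB pscoef1 eqxx v0 subr0. Qed.
Local Hint Extern 0 (psone _) => solve [apply: psone1B] : core.

Lemma vpow0 : vpow (fun=> 0) = 1.
Proof. by rewrite /vpow big1// => j _; rewrite oppr0 npow0. Qed.

Lemma vpow_lower k nu : vpow nu - vpow (lower k nu) = v k * vpow nu.
Proof.
have -> : vpow (lower k nu) = vpow nu * (1 - v k).
  rewrite /vpow /lower; under eq_bigr => j _ do rewrite [- (nu j - _)]opprD opprK npowD//.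
  rewrite big_split /=; congr (_ * _).
  rewrite (bigD1 k)//= eqxx npow_id// big1 ?mulr1// => j /negPf ->.
  by rewrite npow0.
by ring.
Qed.

(** [1 - (1 - v_k) = v_k], and the equation for [v_k] turns the factor [v_k] into
    [w_k] and a shift of the exponents by the row [A k]. *)
Lemma vpow_pascal k nu : eq_below d (vpow nu - vpow (lower k nu))
  (psmon K (u k) * vpow (fun j => nu j - A k j)).
Proof.
rewrite vpow_lower.
apply: eq_below_trans (eq_belowMr (vpow nu) (vE k)) _.
rewrite -mulrA -big_split /= /vpow.
by apply: eq_belowMl; apply: eq_below_prod => j _; rewrite opprB npowD.
Qed.

(** Both sides satisfy Pascal's recursion and agree at [nu = 0]. *)
Lemma lagrange_seriesE nu : eq_below d (lagrange_series nu)
  (lagrange_series (fun=> 0) * vpow nu).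
Proof.
pose F nu := lagrange_series nu - lagrange_series (fun=> 0) * vpow nu.
suff F0 : eq_below d (F nu) 0.
  by move=> e /F0 /eqP; rewrite pscoefB pscoef0 subr_eq0 => /eqP.
apply: pascal_unique => {nu} [nu k|nu k|]; last first.
- by rewrite /F vpow0 mulr1 subrr.
- rewrite /F mulrBr -lagrange_series_pascal mulrCA.
  set a := lagrange_series nu; set b := lagrange_series (lower _ _).
  have -> : a - lagrange_series (fun=> 0) * vpow nu
      - (b - lagrange_series (fun=> 0) * vpow (lower k nu)) =
    a - b - lagrange_series (fun=> 0) * (vpow nu - vpow (lower k nu)) by ring.
  apply: eq_belowD => //; apply: eq_belowN; apply: eq_belowM => //.
  exact: vpow_pascal.
- have : pspoly (fun t => F (fun j => nu j + t * (j == k)%:R)); last by [].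
  apply: pspolyD; first by move=> e; exact: polyfun_lagrange_series.
  apply/pspolyN/pspolyM; first exact: pspoly_cst.
  apply: pspoly_prod => j; apply: pspoly_npow; first exact: pspoly_cst.
  apply: polyfunN; apply: polyfunD; first exact: polyfun_cst.
  by apply: polyfunM; [exact: polyfun_id|exact: polyfun_cst].
Qed.

(** Each [k] in [S] contributes a difference in the direction [k], which
    multiplies the powers of the [1 - v_j] by [v_k]. *)
Lemma wseries_lagrange_coef S nu : eq_below d (wseries (lagrange_coef S nu))
  ((\prod_(k in S) v k) * lagrange_series (fun=> 0) * vpow nu).
Proof.
have [m] := ubnP #|S|; elim: m => // m IH in S nu *; rewrite ltnS => Sm.
have [->|[k kS]] := finset.set_0Vmem S.
  by rewrite big_set0 mul1r; exact: lagrange_seriesE.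
have Sk : (#|S :\ k| < m)%N by rewrite (leq_trans _ Sm)// [in leqRHS](finset.cardsD1 k) kS.
have kSk : k \notin S :\ k by rewrite !inE eqxx.
rewrite -(finset.setD1K kS) (eq_wseries (fun N => lagrange_coefU nu N kSk)) wseriesB.
apply: eq_below_trans (eq_belowD (IH _ _ Sk) (eq_belowN (IH _ _ Sk))) _.
rewrite -mulrBr vpow_lower big_setU1//=.
set X := \prod_(i in _) _; set L := lagrange_series _.
by have -> : X * L * (v k * vpow nu) = v k * X * L * vpow nu by ring.
Qed.

(** The vector [N] is a left kernel vector of the matrix whose determinant is the
    coefficient at [N], so that only [N = 0] contributes. *)
Lemma lagrange_det_coef N :
  \sum_(s : 'S_r) (-1) ^+ s * \sum_(S : {set 'I_r})
    (\prod_k (if k \in S then A (s k) k - (s k == k)%:R else (s k == k)%:R))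
      * lagrange_coef S (fun=> 0) N
  = (N == 0)%:R.
Proof.
pose be k := if N k is m.+1
  then gbinom (shifted_exponent (fun=> 0) N k + m%:R) m else 0.
pose al k := gbinom (shifted_exponent (fun=> 0) N k + (N k)%:R) (N k).
pose M := \matrix_(k, h) ((h == k)%:R * al k + (A h k - (h == k)%:R) * be k).
transitivity (\det M).
  apply: eq_bigr => s _; congr (_ * _).
  under [in RHS]eq_bigr => k _ do rewrite mxE addrC.
  rewrite bigA_distr; apply: eq_bigr => S _; rewrite -big_split /=.
  by apply: eq_bigr => k _; case: ifP.
have [N0|N0] := eqVneq N 0.
  suff -> : M = 1%:M by rewrite det1.
  apply/matrixP => k h; rewrite !mxE /al /be N0 ffunE gbinom0 mulr0 addr0 mulr1.
  by rewrite eq_sym.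
rewrite -det_tr; apply/eqP/det0P; exists (\row_h (N h)%:R).
  apply: contra N0 => /eqP/rowP N0; apply/eqP/ffunP => h; rewrite ffunE.
  by have := N0 h; rewrite !mxE => /eqP; rewrite pnatr_eq0 => /eqP.
apply/rowP => k; rewrite !mxE.
have absorb : (N k)%:R * al k = (shifted_exponent (fun=> 0) N k + (N k)%:R) * be k.
  rewrite /al /be; case: (N k) => [|m]; first by rewrite mul0r mulr0.
  by rewrite -natr1 addrA natr1 mulrC gbinom_absorb.
under eq_bigr => h _ do rewrite !mxE.
transitivity ((N k)%:R * al k
    + (\sum_h (N h)%:R * A h k - (N k)%:R) * be k); last first.
  by rewrite absorb /shifted_exponent sub0r; ring.
rewrite (eq_bigr (fun h => (N h)%:R * A h k * be k
    + (h == k)%:R * ((N h)%:R * (al k - be k)))) => [|h _]; last by ring.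
rewrite big_split /= -mulr_suml [X in _ + X = _](bigD1 k)//= eqxx [X in _ + (_ + X) = _]big1.
  by rewrite mulr1n; ring.
by move=> h /negPf ->; rewrite mul0r.
Qed.

(** Good's form of the Lagrange inversion formula. Multiplying out the determinant
    gives terms [v_S * lagrange_series 0], whose coefficients are known from
    [wseries_lagrange_coef]; they recombine into the determinants of
    [lagrange_det_coef]. *)
Theorem lagrange_good : eq_below d
  (lagrange_series (fun=> 0) *
   \det (\matrix_(h, k) ((h == k)%:R + psC n (A h k - (h == k)%:R) * v k))) 1.
Proof.
have -> : \det (\matrix_(h, k) ((h == k)%:R + psC n (A h k - (h == k)%:R) * v k))
  = \sum_(s : 'S_r) (-1) ^+ s * \sum_(S : {set 'I_r})
    psC n (\prod_k (if k \in S then A (s k) k - (s k == k)%:R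
                    else (s k == k)%:R)) * \prod_(k in S) v k.
  rewrite -det_tr; apply: eq_bigr => s _; congr (_ * _).
  under [in LHS]eq_bigr => k _ do rewrite !mxE addrC.
  rewrite bigA_distr; apply: eq_bigr => S _.
  rewrite (big_morph _ (@psCM n K) (psC1 n K)) [X in _ = _ * X]big_mkcond /=.
  rewrite -big_split /=; apply: eq_bigr => k _; case: ifP => // _.
  by rewrite mulr1 psC_nat.
have E1 : 1 = wseries (fun N => (N == 0)%:R) :> ps.
  by rewrite wseries_const ?eqxx ?psC1// => N /negPf ->.
rewrite [X in eq_below _ _ X]E1 -(eq_wseries lagrange_det_coef) wseries_sum.
rewrite mulr_sumr; apply: eq_below_sum => s _.
rewrite wseriesZ mulrCA.
have -> : psC n ((-1) ^+ s) = (-1) ^+ s :> ps.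
  by case: (odd_perm s); rewrite ?expr0 ?expr1 ?psCN ?psC1.
apply: eq_belowM => //.
rewrite wseries_sum mulr_sumr; apply: eq_below_sum => S _.
rewrite wseriesZ mulrCA; apply: eq_belowM => //.
apply: eq_below_sym; apply: eq_below_trans (wseries_lagrange_coef S _) _.
by rewrite vpow0 mulr1 mulrC.
Qed.

End LagrangeGood.

(** * Determinants *)

(** Sylvester's identity, from two factorizations of one block matrix. *)
Lemma det_1DmulC (R : comNzRingType) m n (X : 'M[R]_(m, n)) (Y : 'M[R]_(n, m)) :
  \det (1%:M + X *m Y) = \det (1%:M + Y *m X).
Proof.
have E1 : block_mx 1%:M X (- Y) 1%:M
    = block_mx 1%:M 0 (- Y) 1%:M *m block_mx 1%:M X 0 (1%:M + Y *m X).
  rewrite mulmx_block !mul1mx !mulmx1 ?mul0mx ?mulmx0 !addr0 mulNmx.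
  by rewrite addrC addrK.
have E2 : block_mx 1%:M X (- Y) 1%:M
    = block_mx (1%:M + X *m Y) X 0 1%:M *m block_mx 1%:M 0 (- Y) 1%:M.
  rewrite mulmx_block !mul1mx !mulmx1 ?mul0mx ?mulmx0 !add0r mulmxN.
  by rewrite addrK.
have := E1; rewrite E2 => /(congr1 determinant).
by rewrite !det_mulmx !det_ublock !det_lblock !det1 !mul1r !mulr1.
Qed.

(** A permutation other than the identity sends the least point that it moves to
    a larger one. *)
Lemma det_trig_well_order (R : comNzRingType) r (ord : rel 'I_r)
    (T : 'M[R]_r) :
  (forall P : pred 'I_r, (exists i, P i) ->
     exists2 i, P i & forall j, P j -> ord i j) ->
  (forall i j, i != j -> ord i j -> T i j = 0) ->
  \det T = \prod_i T i i.
Proof.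
move=> ordP T0; rewrite /determinant (bigD1 1%g)//= odd_perm1 expr0 mul1r.
rewrite [X in _ + X]big1 ?addr0 => [|s s1].
  by apply: eq_bigr => i _; rewrite perm1.
have [|i /= si imin] := ordP (fun i => s i != i).
  apply/existsP; apply: contraR s1 => /existsPn s1.
  by apply/eqP/permP => i; rewrite perm1; have := s1 i; rewrite negbK => /eqP.
rewrite (bigD1 i)//= (T0 i (s i)) ?mul0r ?mulr0 1?eq_sym//.
by apply: imin; rewrite (inj_eq perm_inj).
Qed.

(** * The Jacobian determinant *)

Section Jacobian.
Variables (n r d : nat) (K : numFieldType).
Local Notation ps := (pseries n K).
Variables (u : 'I_r -> mindex n) (A : 'I_r -> 'I_r -> K) (col : 'I_r -> 'I_n).
Variables (v : 'I_r -> ps) (lam : 'I_n -> mindex n -> K) (Q : 'I_n -> ps).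
Variable ord : rel 'I_r.
Hypothesis u_gt0 : forall i, (0 < mdeg (u i))%N.
Hypothesis v0 : forall i, v i 0 = 0.
Hypothesis vE : forall i, eq_below d (v i)
  (psmon K (u i) * \prod_j npow (1 - v j) (A i j)).
Hypothesis QE : forall a, eq_below d (Q a)
  (\prod_k npow (1 - v k) (- (col k == a)%:R)).
Hypothesis lamD : forall b e1 e2, lam b (e1 + e2) = lam b e1 + lam b e2.
Hypothesis ordP : forall P : pred 'I_r, (exists i, P i) ->
  exists2 i, P i & forall j, P j -> ord i j.
Hypothesis A_lam : forall h k, ord h k -> A h k = - lam (col k) (u h).

Let one_v k : psone (1 - v k). Proof. exact: psone1B. Qed.
Let inv k : ps := npow (1 - v k) (- 1).
Let invE k : (1 - v k) * inv k = 1. Proof. exact: npowVr. Qed.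

(** The entries are [- theta_b (log (1 - v_k))]. *)
Let S : 'M[ps]_(r, n) := \matrix_(k, b) (theta (lam b) (v k) * inv k).
Let E : 'M[ps]_(n, r) := \matrix_(a, k) (col k == a)%:R.
(** The matrix of Good's formula with [v] multiplying rows instead of columns,
    which is the form produced by differentiating the equations for [v_h]. *)
Let M : 'M[ps]_r :=
  \matrix_(h, k) ((h == k)%:R + psC n (A h k - (h == k)%:R) * v h).

Let theta_one_v b k : theta (lam b) (1 - v k) = - theta (lam b) (v k).
Proof. by rewrite thetaD thetaN theta1// add0r. Qed.

(** Sylvester's identity moves the [v_k] from the columns to the rows. *)
Lemma lagrange_series_detM :
  eq_below d (lagrange_series u A (fun=> 0) * \det M) 1.
Proof.
have := @lagrange_good _ _ _ u u_gt0 A d v v0 vE.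
pose B : 'M[ps]_r := \matrix_(h, k) psC n (A h k - (h == k)%:R).
pose V : 'M[ps]_r := diag_mx (\row_k v k).
have -> : M = 1%:M + V *m B.
  by rewrite mul_diag_mx; apply/matrixP => h k; rewrite !mxE mulrC.
rewrite det_1DmulC; congr (eq_below d (_ * \det _) 1).
by rewrite mul_mx_diag; apply/matrixP => h k; rewrite !mxE.
Qed.

(** Logarithmic differentiation of the equations for the [v_h]. *)
Lemma mulMS h b : eq_below d ((M *m S) h b) (psC n (lam b (u h)) * v h).
Proof.
have -> : (M *m S) h b
    = theta (lam b) (v h) + v h * \sum_k psC n (A h k) * S k b.
  rewrite mxE mulr_sumr (eq_bigr (fun k => (h == k)%:R * ((1 - v h) * S k b)
    + v h * (psC n (A h k) * S k b))) => [|k _]; last first.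
    by rewrite mxE psCD psCN psC_nat; ring.
  rewrite big_split /= (bigD1 h)//= eqxx mul1r big1 ?addr0 => [|k hk].
    by congr (_ + _); rewrite mxE mulrCA invE mulr1.
  by rewrite eq_sym (negPf hk) mul0r.
set X := \sum_k _.
have step : eq_below d (theta (lam b) (v h))
    (psC n (lam b (u h)) * v h - v h * X).
  apply: eq_below_trans (eq_below_theta (lam b) (vE h)) _.
  rewrite thetaM// theta_mon theta_prod_npow//.
  set p := \prod_j _.
  have -> : \sum_(i < r) psC n (A h i) * theta (lam b) (1 - v i)
      * npow (1 - v i) (- 1) = - X.
    rewrite -sumrN; apply: eq_bigr => k _.
    by rewrite theta_one_v mxE -/(inv k); ring.
  have -> : psC n (lam b (u h)) * psmon K (u h) * p + psmon K (u h) * (p * - X)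
    = psC n (lam b (u h)) * (psmon K (u h) * p) - (psmon K (u h) * p) * X.
    by ring.
  apply: eq_belowD; first exact/eq_belowMl/eq_below_sym.
  by apply/eq_belowN/eq_belowMr/eq_below_sym.
have := eq_belowD step (@eq_below_refl _ _ d (v h * X)).
by rewrite subrK.
Qed.

(** By [A_lam] the rows of [M S E] cancel the multiples [A h k * v h] in [M] on and
    above the diagonal; what remains is triangular with diagonal [1 - v h]. *)
Lemma det_mulM : eq_below d (\det M * \det (1%:M + E *m S)) (\prod_h (1 - v h)).
Proof.
rewrite det_1DmulC -det_mulmx mulmxDr mulmx1 mulmxA.
pose T : 'M[ps]_r := \matrix_(h, k)
  (M h k + psC n (lam (col k) (u h)) * v h).
apply: (@eq_below_trans _ _ _ _ (\det T)).
  apply: eq_below_det => h k; rewrite !mxE; apply: eq_belowD => //.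
  rewrite (bigD1 (col k))//= [E _ _]mxE eqxx mulr1 big1 ?addr0 => [|b bk].
    exact: mulMS.
  by rewrite [E _ _]mxE eq_sym (negPf bk) mulr0.
have TE h k : ord h k -> T h k = (h == k)%:R * (1 - v h).
  by move=> /A_lam hk; rewrite !mxE hk psCD !psCN psC_nat; ring.
rewrite (det_trig_well_order ordP) => [|h k /negPf hk /TE ->]; last first.
  by rewrite hk mul0r.
apply: eq_below_prod => h _; rewrite TE ?eqxx ?mul1r//.
have [|i /eqP -> le_h] := ordP (P := pred1 h); first by exists h; exact: eqxx.
by apply: le_h; exact: eqxx.
Qed.

(** The logarithmic derivatives of the [Q_a] are the entries of [E S], and the
    product of the [Q_a] is the inverse of the product of all [1 - v_k]; so
    [det_mulM] turns the Jacobian into the inverse of [\det M]. *)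
Theorem lagrange_series_jacobian :
  eq_below d (lagrange_series u A (fun=> 0))
    (\det (\matrix_(a, b) ((a == b)%:R * Q a + theta (lam b) (Q a)))).
Proof.
pose q a := \prod_k npow (1 - v k) (- (col k == a)%:R).
have detE : eq_below d
    (\det (\matrix_(a, b) ((a == b)%:R * Q a + theta (lam b) (Q a))))
    ((\prod_a q a) * \det (1%:M + E *m S)).
  have -> : (\prod_a q a) * \det (1%:M + E *m S)
      = \det (diag_mx (\row_a q a) *m (1%:M + E *m S)).
    by rewrite det_mulmx det_diag; congr (_ * _); apply: eq_bigr => a _; rewrite mxE.
  apply: eq_below_det => a b; rewrite mul_diag_mx !mxE.
  apply: (@eq_below_trans _ _ _ _ ((a == b)%:R * q a + theta (lam b) (q a))).
    by apply: eq_belowD; [exact: eq_belowMl|exact: eq_below_theta].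
  rewrite theta_prod_npow// mulrDr [q a * _%:R]mulrC.
  apply: eq_belowD => //; apply: eq_belowMl; apply: eq_below_sum => k _.
  by rewrite theta_one_v !mxE psCN psC_nat -/(inv k) mulrNN mulrA.
have qE : \prod_a q a = \prod_k inv k.
  rewrite /q exchange_big /=; apply: eq_bigr => k _.
  rewrite (bigD1 (col k))//= eqxx big1 ?mulr1// => a /negPf ak.
  by rewrite eq_sym ak oppr0 npow0.
apply: eq_below_sym; apply: eq_below_trans detE _; rewrite qE.
set D := \det _; set L := lagrange_series _ _ _; set J := \prod_k inv k.
have e1 : eq_below d (J * D) (L * \det M * (J * D)).
  rewrite -[X in eq_below _ X _]mul1r.
  exact/eq_belowMr/eq_below_sym/lagrange_series_detM.
apply: eq_below_trans e1 _.
have -> : L * \det M * (J * D) = (\det M * D) * (L * J) by ring.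
apply: eq_below_trans (eq_belowMr _ det_mulM) _.
rewrite mulrCA -big_split /= big1 ?mulr1// => k _; exact: invE.
Qed.

End Jacobian.

(** * Substitution of Laurent monomials *)

Section Substitution.
Variables (n : nat) (K : comNzRingType) (g : 'M[int]_n).
Hypothesis g_unit : \det g != 0.
Local Notation ps := (pseries n K).
Implicit Types (f : ps) (c e : lindex n) (d : mindex n).

Definition yweight d : lindex n := \sum_a yexp g a *+ d a.

Lemma yweightD d1 d2 : yweight (d1 + d2) = yweight d1 + yweight d2.
Proof.
rewrite /yweight -big_split; apply: eq_bigr => i _ /=.
by rewrite ffunE mulrnDr.
Qed.

Lemma yweight0 : yweight 0 = 0.
Proof. by rewrite /yweight big1// => i _; rewrite ffunE mulr0n. Qed.

Lemma yweightE d b : yweight d b = - \sum_a (d a)%:Z * g a b.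
Proof.
rewrite /yweight sum_ffunE -sumrN; apply: eq_bigr => a _.
by rewrite ffunMnE ffunE mulNrn -mulr_natl natz.
Qed.

(** The exponents are the vectors [- d g], and the adjugate of [g] recovers [d] up
    to the nonzero factor [\det g]. *)
Lemma yweight_inj : injective yweight.
Proof.
move=> d1 d2 E; pose w : 'rV[int]_n := \row_a ((d1 a)%:Z - (d2 a)%:Z).
have wg : w *m g = 0.
  apply/rowP => b; have /ffunP/(_ b) := E; rewrite !yweightE => /oppr_inj Eb.
  rewrite !mxE; under eq_bigr do rewrite mxE mulrBl.
  by rewrite sumrB Eb subrr.
have : w *m g *m \adj g = 0 by rewrite wg mul0mx.
rewrite -mulmxA mul_mx_adj mul_mx_scalar => /rowP w0.
apply/ffunP => a; have /eqP := w0 a.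
rewrite !mxE mulf_eq0 (negPf g_unit) /= subr_eq0 => /eqP.
by case.
Qed.

Lemma ysubstE f d : ysubst g f (yweight d) = f d.
Proof.
rewrite /ysubst -/(yweight _).
have -> : [set d' : mindex n | yweight d' = yweight d] = [set d].
  by apply/seteqP; split=> [d' /= /yweight_inj|d' /= ->].
by rewrite fsbig_set1.
Qed.

Lemma ysubst_out f e : (forall d, yweight d <> e) -> ysubst g f e = 0.
Proof.
move=> ne; rewrite /ysubst.
have -> : [set d' : mindex n | yweight d' = e] = set0.
  by apply/seteqP; split=> [d' /= /ne|].
by rewrite fsbig_set0.
Qed.

(** The Laurent series [x^c f(y(x))]; the entries of the determinant all have
    this form, and on it the operations on Laurent series are those on [f]. *)
Definition mon_ysubst c f : laurent n K := fun e => ysubst g f (e - c).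

Lemma mon_ysubstE c f d e : e = c + yweight d -> mon_ysubst c f e = f d.
Proof. by move=> ->; rewrite /mon_ysubst addrC addKr ysubstE. Qed.

Lemma mon_ysubst_out c f e : (forall d, e <> c + yweight d) ->
  mon_ysubst c f e = 0.
Proof.
by move=> ne; apply: ysubst_out => d E; apply: (ne d); rewrite E addrC subrK.
Qed.

Lemma yweight_case c e :
  (exists d, e = c + yweight d) \/ (forall d, e <> c + yweight d).
Proof.
have [[d E]|ne] := pselect (exists d, e = c + yweight d); first by left; exists d.
by right=> d E; apply: ne; exists d.
Qed.

Lemma mon_ysubst_neq0 c f e : mon_ysubst c f e != 0 ->
  exists d, e = c + yweight d.
Proof.
by case: (yweight_case c e) => // /mon_ysubst_out->; rewrite eqxx.
Qed.

Lemma mon_ysubst1 : mon_ysubst 0 1 = lmon K 0.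
Proof.
apply/funext => e; rewrite /lmon.
have [[d E]|ne] := yweight_case 0 e.
  rewrite (mon_ysubstE _ E) pscoef1 E add0r -yweight0 (inj_eq yweight_inj).
  by [].
rewrite mon_ysubst_out//; case: eqP => // e0.
by case: (ne 0); rewrite yweight0 addr0.
Qed.

Lemma lmon_lmul c f : lmul (lmon K c) (ysubst g f) = mon_ysubst c f.
Proof.
apply/funext => e; rewrite /lmul /mon_ysubst.
rewrite -(fsbig_widen [set (c, e - c)]).
- by rewrite fsbig_set1 /= /lmon eqxx mul1r.
- by move=> _ -> /=; rewrite addrC subrK.
move=> [p q] /= [pq ne]; rewrite /lmon; case: eqVneq => [pc|_].
  by case: ne; rewrite -pq pc addrC addKr.
by rewrite mul0r.
Qed.

Lemma lmul_mon_ysubst c1 c2 f1 f2 :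
  lmul (mon_ysubst c1 f1) (mon_ysubst c2 f2) = mon_ysubst (c1 + c2) (f1 * f2).
Proof.
apply/funext => e; rewrite /lmul.
pose h (q : mindex n * mindex n) := (c1 + yweight q.1, c2 + yweight q.2).
have supp p : p.1 + p.2 = e -> mon_ysubst c1 f1 p.1 * mon_ysubst c2 f2 p.2 != 0 ->
    exists2 q, p = h q & e = c1 + c2 + yweight (q.1 + q.2).
  case: p => p1 p2 /= <-; case: (eqVneq (mon_ysubst c1 f1 p1) 0) => [->|].
    by rewrite mul0r eqxx.
  move=> /mon_ysubst_neq0[d1 ->].
  case: (eqVneq (mon_ysubst c2 f2 p2) 0) => [->|].
    by rewrite mulr0 eqxx.
  move=> /mon_ysubst_neq0[d2 ->] _; exists (d1, d2) => //.
  by rewrite /= yweightD addrACA.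
have [[d E]|ne] := yweight_case (c1 + c2) e; last first.
  rewrite mon_ysubst_out// fsbig1// => p /= pe; apply/eqP/negPn/negP.
  by move=> /(supp _ pe)[q _ /ne].
rewrite (mon_ysubstE _ E) -(fsbig_widen (h @` mdecomp d)).
- rewrite (reindex_fsbig h (mdecomp d)).
    transitivity (\sum_(q \in mdecomp d) f1 q.1 * f2 q.2); last by [].
    apply: eq_fsbigr => q _ /=.
    by rewrite (mon_ysubstE f1 erefl) (mon_ysubstE f2 erefl).
  split=> [q qd|q q' _ _|p [q qd <-]]; [by exists q| |by exists q].
  case: q q' => [q1 q2] [q1' q2'] [/addrI/yweight_inj-> /addrI/yweight_inj->].
  by [].
- by move=> _ [q qd <-] /=; rewrite E -qd yweightD addrACA.
move=> p /= [pe np]; apply/eqP/negPn/negP => /(supp _ pe)[q pq Eq].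
apply: np; exists q; rewrite ?pq//.
by apply: yweight_inj; apply: (@addrI _ (c1 + c2)); rewrite -Eq.
Qed.

(** The eigenvalue of [x_b d/dx_b] on the monomial [y(x) ^ d]. *)
Definition yderiv_weight b d : K := (yweight d b)%:~R.

Lemma yderiv_weightD b d1 d2 :
  yderiv_weight b (d1 + d2) = yderiv_weight b d1 + yderiv_weight b d2.
Proof. by rewrite /yderiv_weight yweightD ffunE rmorphD. Qed.

Lemma lderiv_mon_ysubst b c f : lderiv b (mon_ysubst c f) =
  mon_ysubst (c - lunit b)
    (PSeries (fun d => (c b + yweight d b)%:~R * f d)).
Proof.
apply/funext => e; rewrite /lderiv.
have [[d E]|ne] := yweight_case (c - lunit b) e; last first.
  rewrite [RHS]mon_ysubst_out// mon_ysubst_out ?mulr0// => d E.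
  by apply: (ne d); rewrite addrAC -E addrK.
rewrite (mon_ysubstE _ E) (@mon_ysubstE c f d); last first.
  by rewrite E addrAC subrK.
by rewrite E !ffunE eqxx /= addrAC subrK.
Qed.

Lemma ysubst_mon0 f : mon_ysubst 0 f = ysubst g f.
Proof. by apply/funext => e; rewrite /mon_ysubst subr0. Qed.

Lemma big_lmul_mon_ysubst m (c : 'I_m -> lindex n) (F : 'I_m -> ps) :
  \big[@lmul n K/lmon K 0]_(a < m) mon_ysubst (c a) (F a)
  = mon_ysubst (\sum_a c a) (\prod_a F a).
Proof.
rewrite unlock /=; elim: index_enum => [|a s IH] /=.
  by rewrite mon_ysubst1.
by rewrite IH lmul_mon_ysubst.
Qed.

(** The monomials [x_a / x_b] in the entries of the Jacobian matrix cancel along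
    each permutation. *)
Lemma ldet_ysubst (F : 'I_n -> 'I_n -> ps) :
  ldet (fun a b => mon_ysubst (lunit a - lunit b) (F a b))
  = ysubst g (\det (\matrix_(a, b) F a b)).
Proof.
apply/funext => e; rewrite /ldet.
under eq_bigr => s _.
  rewrite big_lmul_mon_ysubst sumrB.
  have -> : \sum_(a < n) lunit a - \sum_(a < n) lunit (s a) = 0 :> lindex n.
    by apply/eqP; rewrite subr_eq0 (reindex_inj (@perm_inj _ s)).
  rewrite ysubst_mon0; over.
have [[d E]|ne] := yweight_case 0 e; last first.
  rewrite [RHS]ysubst_out => [|d E]; last by apply: (ne d); rewrite add0r.
  rewrite big1// => s _; rewrite ysubst_out ?mulr0// => d E.
  by apply: (ne d); rewrite add0r.
rewrite E add0r ysubstE pscoef_sum; apply: eq_bigr => s _.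
rewrite ysubstE; under [in RHS]eq_bigr do rewrite mxE.
have -> : (-1) ^+ s = psC n ((-1) ^+ s) :> ps.
  by case: (odd_perm s); rewrite ?expr0 ?expr1 ?psCN ?psC1.
by rewrite pscoefCM.
Qed.

End Substitution.

(** * From the Q-system to a Lagrange system *)

Lemma pspowE n (R : realType) (f : pseries n R[i]) (a : R[i]) :
  psone f -> pspow f a = npow f a.
Proof.
move=> f1; apply: psP => e; rewrite /pspow /pssum /=.
rewrite -(fsbig_widen `I_((mdeg e).+1))//.
  rewrite -fsbig_ord; apply: eq_bigr => k _.
  by rewrite -[LHS]/((psC n (cbinom a k%:R) * (f - 1) ^+ k) e) pscoefCM cbinomE.
move=> k /= [_ /negP]; rewrite -leqNgt => ek.
rewrite -[LHS]/((psC n (cbinom a k%:R) * (f - 1) ^+ k) e) pscoefCM.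
rewrite (vanish_belowX _ ek) ?mulr0//.
by rewrite pscoefB f1 pscoef1 eqxx subrr.
Qed.

Lemma natmul_natE (x m : nat) : (x *+ m)%R = (x * m)%N.
Proof. by elim: m => [|m IH]; rewrite ?muln0// mulrS IH mulnS. Qed.

Lemma mdegMn n (e : mindex n) m : mdeg (e *+ m) = (mdeg e * m)%N.
Proof.
elim: m => [|m IH]; first by rewrite mulr0n mdeg0 muln0.
by rewrite mulrS mdegD IH mulnS.
Qed.

Lemma psX_exp n (K : comNzRingType) (a : 'I_n) m :
  psX K a ^+ m = psmon K [ffun b => ((b == a) * m)%N].
Proof.
elim: m => [|m IH].
  by rewrite expr0; congr psmon; apply/ffunP => b; rewrite !ffunE muln0.
rewrite exprS IH -psmonD; congr psmon; apply/ffunP => b; rewrite !ffunE.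
by rewrite mulnS.
Qed.

Lemma is_infprod_eq_below n (K : comNzRingType) (I : choiceType)
    (F : I -> pseries n K) p (d : nat) (s : {fset I}) :
  is_infprod F p -> (forall i, i \notin s -> eq_below d (F i) 1) ->
  eq_below d p (\prod_(i <- s) F i).
Proof.
move=> /(_ d)[A0 HA] F1 e ed.
rewrite -(HA (A0 `|` s)%fset (fsubsetUl _ _) e ed).
pose F' i := if i \in s then F i else 1.
have -> : \prod_(i <- s) F i = \prod_(i <- (A0 `|` s)%fset) F' i.
  rewrite -(big_fset_incl _ (fsubsetUr A0 s)) => [|i _ /negPf si].
    by apply: eq_big_seq => i si; rewrite /F' si.
  by rewrite /F' si.
apply: eq_below_prod ed => i _; rewrite /F'; case: ifPn => // /F1.
exact.
Qed.

Lemma is_infprod_finite n (K : comNzRingType) (I : choiceType)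
    (F : I -> pseries n K) p (s : {fset I}) :
  is_infprod F p -> (forall i, i \notin s -> F i = 1) ->
  p = \prod_(i <- s) F i.
Proof.
move=> Fp F1; apply: eq_belowP => d.
by apply: is_infprod_eq_below Fp _ => i /F1 ->.
Qed.

Lemma prod_npow_delta n (K : numFieldType) (I : choiceType)
    (q : I -> pseries n K) (c : K) (s : {fset I}) l0 :
  (forall l, psone (q l)) -> l0 \in s ->
  \prod_(l <- s) npow (q l) (c * (l == l0)%:R) = npow (q l0) c.
Proof.
move=> q1 l0s; rewrite (bigD1_seq l0) ?fset_uniq//= eqxx mulr1 big1 ?mulr1//.
by move=> l /negPf ->; rewrite mulr0 npow0.
Qed.

Section Box.
Variables (n d : nat).
Definition box_size := #|{: 'I_n * 'I_d}|.
(** An enumeration of the pairs [(a, m)] with level at most [d], the only ones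
    that matter below degree [d + 1]. *)
Definition box (i : 'I_box_size) : H n :=
  ((enum_val i).1, nat_of_ord (enum_val i).2).

Lemma box_inj : injective box.
Proof.
move=> i j [E1 E2]; apply: enum_val_inj.
by case: (enum_val i) (enum_val j) E1 E2 => [a m] [b k] /= -> /val_inj ->.
Qed.

Lemma box_lt i : ((box i).2 < d)%N.
Proof. exact: ltn_ord. Qed.

Lemma boxP (h : H n) : (h.2 < d)%N -> exists i, box i = h.
Proof.
case: h => a m /= md; exists (enum_rank (a, Ordinal md)).
by rewrite /box enum_rankK.
Qed.

Lemma big_box (T : Type) (idx : T) (op : Monoid.com_law idx)
    (s : {fset H n}) (F : H n -> T) :
  (forall h, h \in s -> (h.2 < d)%N) -> (forall h, h \notin s -> F h = idx) ->
  \big[op/idx]_(h <- s) F h = \big[op/idx]_(i < box_size) F (box i).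
Proof.
move=> sd F1; rewrite -[RHS](big_map box xpredT F).
rewrite [RHS](bigID (mem s)) /= [X in _ = op _ X]big1 ?Monoid.mulm1; last first.
  by move=> h; exact: F1.
rewrite -[RHS]big_filter; apply: perm_big; apply: uniq_perm.
- exact: fset_uniq.
- by rewrite filter_uniq// (map_inj_uniq box_inj) index_enum_uniq.
move=> h; rewrite mem_filter; case: (boolP (h \in s)) => //= hs.
have [i <-] := boxP (sd h hs).
by rewrite map_f ?mem_index_enum.
Qed.

End Box.

Definition level_index n (h : H n) : mindex n :=
  [ffun b => ((b == h.1) * lev h)%N].

Lemma mdeg_level_index n (h : H n) : mdeg (level_index h) = lev h.
Proof.
rewrite /mdeg (bigD1 h.1)//= ffunE eqxx mul1n big1 ?addn0// => b /negPf bh.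
by rewrite ffunE bh.
Qed.

Section QSystem.
Variables (R : realType) (n : nat) (G : H n -> H n -> R[i]).
Local Notation K := R[i].
Local Notation ps := (pseries n K).
Local Notation Hn := (H n).
Variable Q : 'I_n -> nat -> ps.
Hypothesis hI : KR_I G.
Hypothesis hQ : Qsystem_solution G Q.
Hypothesis hcan : Qsystem_canonical Q.
Implicit Types (h k l : Hn).

Let q h : ps := Q h.1 (lev h).

(** Well-definedness of [G D^-1] forces the rows of [G] to be finite, because the
    entries of [D^-1] between equal colours do not vanish. *)
Lemma finite_support h : finite_set [set l | G h l != 0].
Proof.
apply: (@sub_finite_set _ _
    (\bigcup_(a in [set: 'I_n]) [set l | G h l * KRDinv R l (a, 0%N) != 0])).
  move=> l /= Ghl; exists l.1 => //=.
  rewrite mulf_neq0// /KRDinv eqxx mul1r oppr_eq0 pnatr_eq0 -lt0n.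
  by rewrite leq_min.
by apply: bigcup_finite => // a _; exact: hI.
Qed.

Definition supp h : {fset Hn} := fset_set [set l | G h l != 0].

Lemma G_notin_supp h l : l \notin supp h -> G h l = 0.
Proof.
rewrite in_fset_set; last exact: finite_support.
by apply: contraNeq => Ghl; apply/mem_set.
Qed.

Let Q1 a m : psone (Q a m). Proof. by have [Q0 _ _] := hQ; exact: Q0. Qed.
Let q1 h : psone (q h). Proof. exact: Q1. Qed.

(** By the Q-system [1 - vser h] is [Q_(m-1) Q_(m+1) / Q_m ^ 2]. The product over
    all of [H] reduces to the finite support of a row of [G]. *)
Definition vser h : ps :=
  psmon K (level_index h) * \prod_(l <- supp h) npow (q l) (G h l).

Lemma Qsystem_vser h :
  q h ^+ 2 * (1 - vser h) = Q h.1 h.2 * Q h.1 h.2.+2.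
Proof.
have [_ _ /(_ h)[p pP E]] := hQ; rewrite mulrBr mulr1 [X in X - _]E.
have -> : p = \prod_(l <- supp h) npow (q l) (G h l).
  rewrite (@is_infprod_finite _ _ _ _ _ (supp h) pP) => [|l /G_notin_supp ->].
    by apply: eq_bigr => l _; rewrite pspowE//; exact: q1.
  by rewrite pspowE ?npow0//; exact: Q1.
rewrite psX_exp -/(level_index h) /vser -/(q h).
set P := \prod_(l <- _) _; set X := psmon _ _; rewrite /=.
have -> : X * q h ^+ 2 * P = q h ^+ 2 * (X * P) by ring.
by rewrite addrK.
Qed.

Lemma vser_below h : eq_below (lev h) (vser h) 0.
Proof.
move=> e eh; rewrite pscoef_monM; case: ifPn => // /forallP le_e.
suff : (mdeg (level_index h) <= mdeg e)%N.
  by rewrite mdeg_level_index leqNgt eh.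
by apply: leq_sum => a _.
Qed.

Lemma vser0 h : vser h 0 = 0.
Proof. by rewrite vser_below// mdeg0. Qed.

Let one_v h : psone (1 - vser h).
Proof. by rewrite /psone pscoefB pscoef1 eqxx vser0 subr0. Qed.

(** The entries of [D] are the exponents in [Q_(m-1) Q_(m+1) / Q_m ^ 2], and powers
    distribute over this product. *)
Lemma prod_npow_KRD (F : Hn -> Hn -> ps) h k :
  is_infprod (fun l => pspow (q l) (KRDinv R h k * KRD R k l)) (F h k) ->
  F h k = npow (1 - vser k) (KRDinv R h k).
Proof.
set c := KRDinv R h k; move=> Fhk.
pose up : Hn := (k.1, k.2.+1); pose dn : Hn := (k.1, k.2.-1).
pose b : K := (0 < k.2)%N%:R.
have DE l : KRD R k l = - 2%:R * (l == k)%:R + 1 * (l == up)%:R + b * (l == dn)%:R.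
  rewrite /KRD /b /up /dn /lev; case: k l {c Fhk up dn b} => [a m] [a' m'] /=.
  rewrite !xpair_eqE (eq_sym a); case: (a' == a) => /=; last by ring.
  have -> : (m.+1 == m'.+1) = (m' == m) by lia.
  have -> : (m.+2 == m'.+1) = (m' == m.+1) by lia.
  have -> : (m.+1 == m'.+2) = (0 < m)%N && (m' == m.-1) by lia.
  by rewrite -mulnb natrM; ring.
pose s3 := [fset k; up; dn]%fset.
have -> : F h k = \prod_(l <- s3) npow (q l) (c * KRD R k l).
  rewrite (@is_infprod_finite _ _ _ _ _ s3 Fhk) => [|l].
    by apply: eq_bigr => l _; rewrite pspowE//; exact: q1.
  rewrite !inE !negb_or -!andbA => /and3P[/negPf lk /negPf lu /negPf ld].
  by rewrite pspowE// DE lk lu ld !mulr0 !addr0 mulr0 npow0.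
have -> : \prod_(l <- s3) npow (q l) (c * KRD R k l)
    = npow (q k) (c * - 2%:R) * npow (q up) c * npow (q dn) (c * b).
  rewrite -(@prod_npow_delta _ _ _ q (c * - 2%:R) s3 k)// ?inE ?eqxx//.
  rewrite -(@prod_npow_delta _ _ _ q c s3 up)// ?inE ?eqxx ?orbT//.
  rewrite -(@prod_npow_delta _ _ _ q (c * b) s3 dn)// ?inE ?eqxx ?orbT//.
  rewrite -!big_split /=; apply: eq_bigr => l _.
  by rewrite -!npowD// DE; congr npow; ring.
have -> : npow (q dn) (c * b) = npow (Q k.1 k.2) c.
  rewrite /b /dn /q /lev /=; case: k.2 => [|m] /=; last by rewrite mulr1.
  have [_ Q0 _] := hQ.
  by rewrite mulr0 npow0 ?Q0 ?npow1//.
have -> : 1 - vser k = npow (q k) (- 2%:R) * (Q k.1 k.2 * Q k.1 k.2.+2).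
  rewrite -Qsystem_vser mulrA -(npow_nat 2 (q1 k)) -npowD// addNr npow0//.
  by rewrite mul1r.
rewrite (npowMl _ (psone_npow _ _) (psoneM (Q1 _ _) (Q1 _ _))).
rewrite (npowM _ _ (q1 k)) (npowMl _ (Q1 _ _) (Q1 _ _)) [- 2%:R * c]mulrC.
have -> : q up = Q k.1 k.2.+2 by [].
set x := npow (q k) _; set z := npow (Q k.1 k.2.+2) c; set y := npow _ c.
by move: x y z => x y z; rewrite -mulrA [z * y]mulrC.
Qed.

(** Canonicity says that the [Q_h] are the products which the [1 - v_k] suggest;
    in bounded degree only finitely many of them matter. *)
Lemma canonical_box d h : eq_below d (q h)
  (\prod_(i < box_size n d) npow (1 - vser (box i)) (KRDinv R h (box i))).
Proof.
have [F FE Fq] := hcan.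
have {}Fq : is_infprod (fun k => npow (1 - vser k) (KRDinv R h k)) (q h).
  have -> : (fun k => npow (1 - vser k) (KRDinv R h k)) = F h.
    by apply/funext => k; rewrite (prod_npow_KRD (FE h k)).
  exact: Fq.
pose s := [fset box i | i in 'I_(box_size n d)]%fset.
have sP k : (k \in s) = (k.2 < d)%N.
  apply/imfsetP/idP => [[i _ ->]|/boxP[i <-]]; first exact: box_lt.
  by exists i.
apply: eq_below_trans (is_infprod_eq_below (s := s) Fq _) _.
  move=> k; rewrite sP -leqNgt => dk; apply: eq_below1_npow.
  have := eq_belowW (leqW dk) (vser_below (h := k)).
  move=> /eq_belowN vk e ed.
  by rewrite pscoefD vk// oppr0 addr0.
pose F' k := if k \in s then npow (1 - vser k) (KRDinv R h k) else 1.
rewrite (eq_big_seq F') => [|k ks]; last by rewrite /F' ks.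
rewrite (@big_box n d) => [|k|k /negPf ks]; first last.
- by rewrite /F' ks.
- by rewrite sP.
rewrite (eq_bigr (fun i => npow (1 - vser (box i)) (KRDinv R h (box i))))//.
by move=> i _; rewrite /F' sP box_lt.
Qed.

Lemma GDinvE h k : GDinv G h k = \sum_(l <- supp h) KRDinv R l k * G h l.
Proof.
rewrite /GDinv -(fsbig_widen [set l | G h l != 0])//.
  rewrite fsbig_finite; last exact: finite_support.
  by apply: eq_bigr => l _; rewrite mulrC.
by move=> l /= [_ /negP]; rewrite negbK => /eqP ->; rewrite mul0r.
Qed.

(** Substitute the product formula for the [Q_l] into the definition of [vser h];
    the exponents multiply to [G D^-1]. *)
Lemma vser_box d h : eq_below d (vser h)
  (psmon K (level_index h) *
   \prod_(i < box_size n d) npow (1 - vser (box i)) (GDinv G h (box i))).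
Proof.
rewrite /vser; apply: eq_belowMl.
rewrite (eq_bigr (fun i => \prod_(l <- supp h)
    npow (1 - vser (box i)) (KRDinv R l (box i) * G h l))) => [|i _]; last first.
  by rewrite GDinvE npow_sum//; exact: one_v.
rewrite exchange_big /=; apply: eq_below_prod => l _.
apply: eq_below_trans (eq_below_npow (G h l) (@canonical_box d l)) _.
rewrite npow_prod => [|i]; last exact: psone_npow.
by apply: eq_below_prod => i _; rewrite npowM//; exact: one_v.
Qed.

(** Below degree [d] the vacuum sum only involves occupation numbers supported in
    the box, so it is the coefficient of a Lagrange series. *)
Lemma K0_box d : eq_below d (K0 G)
  (lagrange_series (fun i => level_index (box (d := d) i))
     (fun i j => GDinv G (box i) (box j)) (fun=> 0)).
Proof.
move=> e ed; rewrite /K0 /pssum [LHS]/=.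
pose wt (N : {fsfun Hn -> nat with 0%N}) :=
  \sum_(h <- finsupp N) level_index h *+ N h.
pose c (N : {fsfun Hn -> nat with 0%N}) :=
  \prod_(h <- finsupp N) gbinom (Pvac G N h + (N h)%:R) (N h).
have termE (N : {fsfun Hn -> nat with 0%N}) :
   (psC n (\prod_(h <- finsupp N) cbinom (Pvac G N h + (N h)%:R) (N h)%:R)
    * \prod_(h <- finsupp N) psX R[i] h.1 ^+ (lev h * N h)) e
   = c N * (e == wt N)%:R.
  rewrite pscoefCM; congr (_ * _).
    by apply: eq_bigr => h _; rewrite cbinomE.
  have -> : \prod_(h <- finsupp N) psX R[i] h.1 ^+ (lev h * N h)
      = psmon R[i] (wt N).
    rewrite (big_morph (psmon R[i]) (@psmonD n R[i]) erefl).
    apply: eq_bigr => h _; rewrite psX_exp; congr psmon; apply/ffunP => b.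
    by rewrite ffunMnE !ffunE natmul_natE mulnA.
  by [].
have -> : (\sum_(N \in [set: {fsfun Hn -> nat with 0%N}])
    (psC n (\prod_(h <- finsupp N) cbinom (Pvac G N h + (N h)%:R) (N h)%:R)
      * \prod_(h <- finsupp N) psX R[i] h.1 ^+ (lev h * N h)) e)
    = \sum_(N \in [set N | wt N = e]) c N.
  rewrite -(fsbig_widen [set N | wt N = e])//.
    by apply: eq_fsbigr => N /set_mem Ne; rewrite termE Ne eqxx mulr1.
  move=> N [_ /= Ne]; apply: etrans (termE N) _; case: eqVneq => [eN|_].
    by case: Ne.
  by rewrite mulr0.
have supp_box (N : {fsfun Hn -> nat with 0%N}) : wt N = e ->
    forall h, h \in finsupp N -> (h.2 < d)%N.
  move=> Ne h hN; apply: leq_ltn_trans ed; apply: (@leq_trans (lev h * N h)).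
    by apply: (@leq_trans (lev h)); rewrite // leq_pmulr// lt0n -mem_finsupp.
  rewrite -(mdeg_level_index h) -mdegMn.
  rewrite -Ne /wt (bigD1_seq h) ?fset_uniq//= mdegD; exact: leq_addr.
(* Below degree [d], restriction to the box loses nothing. *)
pose restr (N : {fsfun Hn -> nat with 0%N}) : mindex (box_size n d) :=
  [ffun i => N (box i)].
have weight_restr (N : {fsfun Hn -> nat with 0%N}) :
    (forall h, h \in finsupp N -> (h.2 < d)%N) ->
    weight (fun i => level_index (box (d := d) i)) (restr N) = wt N.
  move=> Nd; rewrite /wt (@big_box n d)// => [|h hN].
    by apply: eq_bigr => i _; rewrite ffunE.
  by rewrite (fsfun_dflt hN) mulr0n.
have level_gt0 i : (0 < mdeg (level_index (box (n := n) (d := d) i)))%N.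
  by rewrite mdeg_level_index.
rewrite [RHS]/= /weight_fiber.
rewrite -(fsbig_finite _ _ (finite_weight_fiber level_gt0 e)).
rewrite (reindex_fsbig restr [set N | wt N = e]).
  apply: eq_fsbigr => N /set_mem /= Ne; rewrite /c (@big_box n d); first last.
  - by move=> h hN; rewrite (fsfun_dflt hN) gbinom0.
  - exact: supp_box.
  apply: eq_bigr => i _; rewrite finset.in_set0 ffunE.
  congr (gbinom (_ + _) _); rewrite /Pvac /shifted_exponent sub0r; congr (- _).
  rewrite (@big_box n d); first last.
  - by move=> h hN; rewrite (fsfun_dflt hN) mul0r.
  - exact: supp_box.
  by apply: eq_bigr => j _; rewrite ffunE.
split=> [N /= Ne|N N' /set_mem /= Ne /set_mem /= Ne' /ffunP NN'|N' /= Ne].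
- by rewrite weight_restr//; exact: supp_box.
- apply/fsfunP => h; have [/boxP[i <-]|dh] := ltnP h.2 d.
    by have := NN' i; rewrite !ffunE.
  by rewrite !fsfun_dflt//; apply/negP => /supp_box; rewrite ltnNge dh => /(_ _)/negP;
    apply.
pose s := [fset box i | i in 'I_(box_size n d)]%fset.
pose N : {fsfun Hn -> nat with 0%N} :=
  [fsfun h in s => (\sum_(i | box i == h) N' i)%N].
have NE : restr N = N'.
  apply/ffunP => i; rewrite ffunE fsfunE.
  rewrite in_imfset//= (big_pred1 i)// => j.
  by rewrite (inj_eq (@box_inj _ _)).
exists N => //=; rewrite -weight_restr ?NE// => h.
rewrite mem_finsupp fsfunE; case: ifP => // /imfsetP[i _ ->] _.
exact: box_lt.
Qed.

End QSystem.

(** * Kirillov-Reshetikhin type: the vacuum sum as a Jacobian *)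

Lemma well_order_box n (ord : rel (H n)) d :
  wochoice.well_order ord ->
  forall P : pred 'I_(box_size n d), (exists i, P i) ->
    exists2 i, P i & forall j, P j -> ord (box i) (box j).
Proof.
move=> wo P [i0 Pi0]; pose B h := [exists i, P i && (box i == h)].
have [|z [[/existsP[i /andP[Pi /eqP <-]] zmin] _]] := wo B.
  by exists (box i0); apply/existsP; exists i0; rewrite Pi0 eqxx.
exists i => // j Pj; apply: zmin; apply/existsP; exists j.
by rewrite Pj eqxx.
Qed.

(** The identity before the substitution of [y(x)], where
    [x_b * d (x_a f) / d x_b = x_a (delta_ab f + theta_b f)]. *)
Theorem K0_jacobian (R : realType) (n : nat)
  (G : H n -> H n -> R[i]) (g : 'M[int]_n)
  (hI : KR_I G) (hII : KR_II G g)
  (Q : 'I_n -> nat -> pseries n R[i])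
  (hQ : Qsystem_solution G Q) (hcan : Qsystem_canonical Q) :
  K0 G = \det (\matrix_(a, b) ((a == b)%:R * Q a 1%N
    + theta (yderiv_weight R[i] g b) (Q a 1%N))).
Proof.
have [[ord wo Gord] gdet] := hII.
apply: eq_belowP => d; apply: eq_below_trans; first exact: (@K0_box _ _ G d).
apply: (@lagrange_series_jacobian n _ d _ _ _ (fun i => (box (d := d) i).1)
  (fun i => vser G Q (box i)) (yderiv_weight R[i] g) (fun a => Q a 1%N)
  (fun i j => ord (box i) (box j))).
- by move=> i; rewrite mdeg_level_index.
- by move=> i; exact: vser0.
- by move=> i; exact: vser_box.
- move=> a; apply: eq_below_trans; first exact: (canonical_box hI hQ hcan (a, 0%N)).
  apply: eq_below_prod => i _; rewrite /KRDinv /= eq_sym /lev /=.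
  by rewrite minnSS min0n mulr1.
- by move=> b e1 e2; exact: yderiv_weightD.
- exact: (well_order_box wo).
move=> i j /Gord ->.
rewrite /yderiv_weight yweightE rmorphN opprK.
rewrite (bigD1 (box i).1)//= big1 ?addr0 => [|a /negPf ai].
  by rewrite ffunE eqxx mul1n rmorphM /= mulrC.
by rewrite ffunE ai mul0n mul0r.
Qed.

Theorem proposition4p9 (R : realType) (n : nat) (n_gt0 : (0 < n)%N)
  (G : H n -> H n -> R[i]) (g : 'M[int]_n)
  (hI : KR_I G) (hII : KR_II G g)
  (Q : 'I_n -> nat -> pseries n R[i])
  (hQ : Qsystem_solution G Q) (hcan : Qsystem_canonical Q) :
  K0x G g = ldet (fun a b => lderiv b (Q1x g Q a)).
Proof.
have [_ g0] := hII; rewrite /K0x (K0_jacobian hI hII hQ hcan).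
rewrite -(ldet_ysubst g0); congr ldet; apply/funext => a; apply/funext => b.
rewrite /Q1x lmon_lmul (lderiv_mon_ysubst g0); congr mon_ysubst.
apply: psP => e; rewrite pscoefD -psC_nat pscoefCM /= rmorphD mulrDl.
by congr (_ * _ + _); rewrite ffunE eq_sym.
Qed.
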